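(* Let $\mathfrak E$ be a tropical toric vector bundle on a smooth, projective toric variety $X_\Sigma$ of dimension $d$, and let $\mathcal L$ be an ample ($T$-linearized) line bundle on $X_\Sigma$. Then there is an integer $N_0>0$ such that for all $N\ge N_0$ and all $u\in M$, $$\chi(X_\Sigma,\mathfrak E\otimes\mathcal L^{\otimes N})_u=h^0(X_\Sigma,\mathfrak E\otimes\mathcal L^{\otimes N})_u .$$ Moreover, for $N\ge N_0$, $h^0(X_\Sigma,\mathfrak E\otimes\mathcal L^{\otimes N})$ is given by an integral (integer-valued) polynomial of degree $d$ in $N$.
   Context: $N_{\mathbb R}=N\otimes\mathbb R$ for a lattice $N\cong\mathbb Z^d$ with dual (character) lattice $M$; $\Sigma$ is a complete fan in $N_{\mathbb R}$ with rays $\rho_1,\dots,\rho_n$ and primitive generators $\mathbf v_1,\dots,\mathbf v_n$; $\sigma(1)$ denotes the set of rays of $\sigma\in\Sigma$. $\mathcal M$ is a loop-free matroid of rank $r\geq 1$ on $\{1,\dots,m\}$. $\operatorname{Berg}(\mathcal M)\subset\mathbb R^m$ is the set of $w$ such that for every circuit $C$ the minimum $\min_{i\in C}w_i$ is attained at least twice (equivalently, all sets $\{i:w_i\ge t\}$ are flats). For a basis $B$, the apartment $A_B$ is the set of $w\in\operatorname{Berg}(\mathcal M)$ for which $\sum_{b\in B}w_b$ is maximal among all bases; projection to the $B$-coordinates is a bijection $A_B\to\mathbb R^B$. A tropical toric vector bundle $\mathfrak E$ over $X_\Sigma$ with matroid $\mathcal M$ is a map $\Phi:N_{\mathbb R}\to\operatorname{Berg}(\mathcal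 M)$ with $\Phi(N)\subset\mathbb Z^m$ such that for each $\sigma\in\Sigma$ there is a basis $B_\sigma$ with $\Phi(\sigma)\subset A_{B_\sigma}$ and $\Phi|_\sigma$, in the coordinates $A_{B_\sigma}\cong\mathbb R^{B_\sigma}$, the restriction of a linear map. Write $\mathfrak v(e)(x)=\Phi(x)_e$ for $e\in\mathcal M$. A $T$-linearized line bundle $\mathcal L$ is given by $(r_1,\dots,r_n)\in\mathbb Z^n$, equivalently by the function $\psi:N_{\mathbb R}\to\mathbb R$ linear on the cones of $\Sigma$ with $\psi(\mathbf v_j)=r_j$. It is ample iff the polytope $\{y\in M_{\mathbb R}:\langle y,\mathbf v_j\rangle\le r_j\ \forall j\}$ has outer normal fan $\Sigma$, each inequality being tight on the corresponding facet. $\mathfrak E\otimes\mathcal L$ is the tropical toric vector bundle with the same matroid and $\mathfrak v_{\mathfrak E\otimes\mathcal L}(e)=\mathfrak v(e)+\psi$ for all $e$. For $u\in M$: $H^0(X_\Sigma,\mathfrak E)_u=\{e\in\mathcal M:\langle u,\mathbf v_\rho\rangle\le\mathfrak v(e)(\mathbf v_\rho)\ \forall\rho\in\Sigma(1)\}$; $h^0(X_\Sigma,\mathfrak E)_u$ is the rank of this subset of $\mathcal M$; $h^0(X_\Sigma,\mathfrak E)=\sum_{u\in M}h^0(X_\Sigma,\mathfrak E)_u$; and $$\chi(X_\Sigma,\mathfrak E)_u=\sum_{\sigma\in\Sigma}(-1)^{\operatorname{codim}\sigma}\operatorname{rank}\{e\in\mathcal M:\langle u,\mathbf v_\rho\rangle\le\mathfrak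 v(e)(\mathbf v_\rho)\ \forall\rho\in\sigma(1)\},$$ the sum being over all cones including $\{0\}$. *)

(* Defs.v *)
From HB Require Import structures.
From mathcomp Require Import all_boot all_order all_algebra.
From mathcomp Require Import all_classical all_reals.

Set Implicit Arguments.
Unset Strict Implicit.
Unset Printing Implicit Defensive.

Import Order.TTheory GRing.Theory Num.Theory.

Local Open Scope classical_set_scope.
Local Open Scope ring_scope.

Record matroid (E : finType) := Matroid {
  indep : pred {set E};
  indep0 : indep finset.set0;
  indepS : forall I J : {set E}, I \subset J -> indep J -> indep I;
  indep_exchange : forall I J : {set E}, indep I -> indep J ->
    (#|I| < #|J|)%N -> exists2 e, e \in J :\: I & indep (e |: I)
}.

Section MatroidTheory.
Variables (E : finType) (M : matroid E).

Definition mrank (A : {set E}) : nat :=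
  \max_(I : {set E} | (I \subset A) && indep M I) #|I|.

Definition mbasis (B : {set E}) : bool := maxset (indep M) B.

Definition circuit (C : {set E}) : bool := minset (fun X => ~~ indep M X) C.

Definition loopfree : Prop := forall e : E, indep M [set e]%SET.

Lemma mbasis_card (B B' : {set E}) : mbasis B -> mbasis B' -> #|B| = #|B'|.
Proof.
have le (X Y : {set E}) : mbasis X -> mbasis Y -> (#|Y| <= #|X|)%N.
  move=> /maxsetP[iX maxX] /maxsetP[iY _]; rewrite leqNgt; apply/negP => ltXY.
  have [e /setDP[_ eX] ieX] := indep_exchange iX iY ltXY.
  by move: eX; rewrite -(maxX _ ieX (finset.subsetUr _ _)) setU11.
by move=> bB bB'; apply/eqP; rewrite eqn_leq !le.
Qed.

End MatroidTheory.

Section Bergman.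
Variables (R : realType) (m : nat) (M : matroid 'I_m).

Definition berg : set 'rV[R]_m := [set w |
  forall C : {set 'I_m}, circuit M C ->
    exists i j : 'I_m, [/\ i \in C, j \in C, i != j, w 0 i = w 0 j &
      forall k, k \in C -> w 0 i <= w 0 k]].

Definition apartment (B : {set 'I_m}) : set 'rV[R]_m := [set w | berg w /\
  forall B' : {set 'I_m}, mbasis M B' ->
    \sum_(b in B') w 0 b <= \sum_(b in B) w 0 b].

End Bergman.

(* Both the lattice N and its dual M are 'rV[int]_d, with the standard
   pairing; N_R and M_R are both 'rV[R]_d. *)
Definition emb (R : realType) (k : nat) (v : 'rV[int]_k) : 'rV[R]_k :=
  map_mx intr v.

Definition pairing (R : realType) (d : nat) (y x : 'rV[R]_d) : R :=
  \sum_(i < d) y 0 i * x 0 i.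

Definition primitive (d : nat) (v : 'rV[int]_d) : Prop :=
  v != 0 /\ forall (k : nat) (w : 'rV[int]_d), v = w *+ k -> k = 1%N.

Section Cones.
Variables (R : realType) (d : nat).

Definition gen_cone (n : nat) (v : 'I_n -> 'rV[int]_d) (S : {set 'I_n}) :
    set 'rV[R]_d :=
  [set x | exists2 a : 'I_n -> R, (forall i, 0 <= a i) &
                                  x = \sum_(i in S) a i *: emb R (v i)].

Definition is_face (tau sigma : set 'rV[R]_d) : Prop :=
  exists y : 'rV[R]_d, (forall x, sigma x -> 0 <= pairing y x) /\
    tau = [set x | sigma x /\ pairing y x = 0].

End Cones.

(* A cone sigma is encoded by the set S of indices of its rays, sigma(1);
   [fan_rays] says that S is exactly this set, so that distinct members of
   [cones] generate distinct cones and distinct indices give distinct rays. *)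
Record complete_fan (R : realType) (d n : nat) := CompleteFan {
  ray : 'I_n -> 'rV[int]_d;
  cones : {set {set 'I_n}};
  fan_primitive : forall i, primitive (ray i);
  fan_ray_in : forall i, [set i]%SET \in cones;
  fan_pointed : forall S, S \in cones -> forall x : 'rV[R]_d,
    gen_cone ray S x -> gen_cone ray S (- x) -> x = 0;
  fan_rays : forall S, S \in cones -> forall i,
    i \in S <-> is_face (@gen_cone R d n ray [set i]%SET) (gen_cone ray S);
  fan_face : forall S, S \in cones -> forall tau : set 'rV[R]_d,
    is_face tau (gen_cone ray S) ->
    exists2 T, T \in cones & tau = gen_cone ray T;
  fan_meet : forall S T, S \in cones -> T \in cones ->
    is_face (@gen_cone R d n ray S `&` gen_cone ray T) (gen_cone ray S);
  fan_complete : forall x : 'rV[R]_d,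
    exists2 S, S \in cones & gen_cone ray S x
}.

Section Toric.
Variables (R : realType) (d n : nat) (Sigma : complete_fan R d n).

Definition fcone (S : {set 'I_n}) : set 'rV[R]_d := gen_cone (ray Sigma) S.

Definition codim (S : {set 'I_n}) : nat :=
  (d - \dim <<[seq emb R (ray Sigma i) | i in S]>>%VS)%N.

(* The ray generators of each cone are part of a Z-basis of N, here the rows
   of a unimodular matrix. *)
Definition smooth : Prop := forall S, S \in cones Sigma ->
  exists (A : 'M[int]_d) (f : 'I_n -> 'I_d),
    [/\ A \in unitmx, {in S &, injective f} &
        forall i, i \in S -> row (f i) A = ray Sigma i].

(* T-linearized line bundles: the integers r_j together with the piecewise
   linear function psi that they determine. *)
Record line_bundle := LineBundle {
  lcoef : 'I_n -> int;
  lpsi : 'rV[R]_d -> R;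
  lpsi_linear : forall S, S \in cones Sigma ->
    exists f : {scalar 'rV[R]_d}, forall x, fcone S x -> lpsi x = f x;
  lpsi_ray : forall j, lpsi (emb R (ray Sigma j)) = (lcoef j)%:~R
}.

Lemma lpow_linear (L : line_bundle) (N : nat) S : S \in cones Sigma ->
  exists f : {scalar 'rV[R]_d}, forall x, fcone S x -> lpsi L x *+ N = f x.
Proof.
move=> /(lpsi_linear L)[f fE].
have lf : scalar (fun x => f x *+ N).
  by move=> a x y /=; rewrite linearP mulrnDl -mulrnAr.
pose g : {scalar 'rV[R]_d} :=
  HB.pack (fun x => f x *+ N) (GRing.isLinear.Build _ _ _ _ _ lf).
by exists g => x /fE ->.
Qed.

Lemma lpow_ray (L : line_bundle) (N : nat) j :
  lpsi L (emb R (ray Sigma j)) *+ N = (lcoef L j *+ N)%:~R.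
Proof. by rewrite lpsi_ray raddfMn. Qed.

Definition lpow (L : line_bundle) (N : nat) : line_bundle :=
  LineBundle (lpow_linear L N) (lpow_ray L N).

Definition lpolytope (L : line_bundle) : set 'rV[R]_d :=
  [set y | forall j, pairing y (emb R (ray Sigma j)) <= (lcoef L j)%:~R].

Definition max_face (P : set 'rV[R]_d) (x : 'rV[R]_d) : set 'rV[R]_d :=
  [set y | P y /\ forall z, P z -> pairing z x <= pairing y x].

Definition poly_face (P F : set 'rV[R]_d) : Prop :=
  F !=set0 /\ exists x, F = max_face P x.

Definition normal_cone (P F : set 'rV[R]_d) : set 'rV[R]_d :=
  [set x | F `<=` max_face P x].

Definition outer_normal_fan (P : set 'rV[R]_d) : set (set 'rV[R]_d) :=
  [set K | exists2 F, poly_face P F & K = normal_cone P F].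

(* The facet corresponding to the ray rho_j is the face whose normal cone is
   rho_j. *)
Definition ample (L : line_bundle) : Prop :=
  outer_normal_fan (lpolytope L)
    = [set K | exists2 S, S \in cones Sigma & K = fcone S] /\
  forall j F, poly_face (lpolytope L) F ->
    normal_cone (lpolytope L) F = fcone [set j]%SET ->
    forall y, F y -> pairing y (emb R (ray Sigma j)) = (lcoef L j)%:~R.

Definition projective : Prop := exists L : line_bundle, ample L.

Section Bundles.
Variables (m : nat) (M : matroid 'I_m).

(* A linear map to R^B is given by its coordinates, one linear form for each
   b in B. *)
Record tropical_bundle := TropicalBundle {
  Phi : 'rV[R]_d -> 'rV[R]_m;
  Phi_berg : forall x, berg M (Phi x);
  Phi_int : forall v : 'rV[int]_d,
    exists w : 'rV[int]_m, Phi (emb R v) = emb R w;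
  Phi_linear : forall S, S \in cones Sigma -> exists2 B : {set 'I_m},
    mbasis M B &
    (forall x, fcone S x -> apartment M B (Phi x)) /\
    (forall b, b \in B -> exists f : {scalar 'rV[R]_d},
       forall x, fcone S x -> Phi x 0 b = f x)
}.

Section Tensor.
Variables (smoothS : smooth) (E : tropical_bundle) (L : line_bundle).

Definition tensor_fun (x : 'rV[R]_d) : 'rV[R]_m :=
  \row_(e < m) (Phi E x 0 e + lpsi L x).

Lemma tensor_berg x : berg M (tensor_fun x).
Proof.
move=> C /(Phi_berg E x)[i [j [iC jC ij eij lei]]].
exists i, j; split=> //; first by rewrite !mxE eij.
by move=> k kC; rewrite !mxE lerD2r lei.
Qed.

Lemma lpsi_int (v : 'rV[int]_d) : exists k : int, lpsi L (emb R v) = k%:~R.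
Proof.
have [S SS [a a0 va]] := fan_complete Sigma (emb R v).
have [A [f [uA injf fA]]] := smoothS SS.
have [g gE] := lpsi_linear L SS.
have cS i : i \in S -> fcone S (emb R (ray Sigma i)).
  move=> iS; exists (fun j => (j == i)%:R) => [j|]; first exact: ler0n.
  rewrite (bigD1 i) //= eqxx scale1r big1 ?addr0 // => j /andP[_ /negPf->].
  by rewrite scale0r.
have aint i : i \in S -> a i = ((v *m invmx A) 0 (f i))%:~R.
  move=> iS; transitivity ((emb R (v *m invmx A)) 0 (f i)); last by rewrite mxE.
  rewrite /emb map_mxM -/(emb R v) va mulmx_suml summxE (bigD1 i) //=.
  have rowE j : j \in S -> map_mx intr (ray Sigma j) *m map_mx intr (invmx A)
      = delta_mx 0 (f j) :> 'rV[R]_d.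
    by move=> jS; rewrite -map_mxM -fA // -row_mul mulmxV // row1 map_delta_mx.
  rewrite -scalemxAl mxE rowE // mxE !eqxx mulr1 big1 ?addr0 // => j /andP[jS ji].
  rewrite -scalemxAl mxE rowE // mxE eqxx /= (inj_in_eq injf) //.
  by rewrite eq_sym (negPf ji) mulr0.
exists (\sum_(i in S) (v *m invmx A) 0 (f i) * lcoef L i).
rewrite gE; last by exists a.
rewrite va linear_sum rmorph_sum /=; apply: eq_bigr => i iS.
by rewrite linearZ /= -gE ?lpsi_ray ?aint ?rmorphM //; exact: cS.
Qed.

Lemma tensor_int (v : 'rV[int]_d) :
  exists w : 'rV[int]_m, tensor_fun (emb R v) = emb R w.
Proof.
have [w Ew] := Phi_int E v; have [k Ek] := lpsi_int v.
exists (\row_e (w 0 e + k)); apply/rowP => e.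
by rewrite !mxE Ew Ek !mxE rmorphD.
Qed.

Lemma tensor_linear S : S \in cones Sigma -> exists2 B : {set 'I_m},
  mbasis M B &
  (forall x, fcone S x -> apartment M B (tensor_fun x)) /\
  (forall b, b \in B -> exists f : {scalar 'rV[R]_d},
     forall x, fcone S x -> tensor_fun x 0 b = f x).
Proof.
move=> SS; have [B bB [ApB linB]] := Phi_linear E SS.
have [g gE] := lpsi_linear L SS.
exists B => //; split=> [x Sx|b bInB].
- split=> [|B' bB']; first exact: tensor_berg.
  have -> : tensor_fun x = Phi E x + const_mx (lpsi L x).
    by apply/rowP => e; rewrite !mxE.
  have sumE (A : {set 'I_m}) :
      \sum_(b in A) (Phi E x + const_mx (lpsi L x)) 0 b
      = \sum_(b in A) Phi E x 0 b + lpsi L x *+ #|A|.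
    rewrite -sumr_const -big_split /=; apply: eq_bigr => b _.
    by rewrite !mxE.
  rewrite !sumE (mbasis_card bB' bB) lerD2r.
  exact: (ApB x Sx).2.
- have [f fE] := linB b bInB.
  have lf : scalar (fun x => f x + g x).
    by move=> a x y /=; rewrite !linearP /= mulrDr addrACA.
  pose h : {scalar 'rV[R]_d} :=
    HB.pack (fun x => f x + g x) (GRing.isLinear.Build _ _ _ _ _ lf).
  by exists h => x Sx; rewrite mxE fE // gE.
Qed.

Definition tensor : tropical_bundle :=
  TropicalBundle tensor_berg tensor_int tensor_linear.

End Tensor.

Section Cohomology.
Variable E : tropical_bundle.

Definition sections (S : {set 'I_n}) (u : 'rV[int]_d) : {set 'I_m} :=
  [set e : 'I_m | [forall (j | j \in S),
     pairing (emb R u) (emb R (ray Sigma j))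
       <= Phi E (emb R (ray Sigma j)) 0 e]]%SET.

Definition h0_deg (u : 'rV[int]_d) : nat := mrank M (sections [set: 'I_n]%SET u).

(* The sum has finite support because the fan is complete (a sum over [setT]
   with infinite support would be 0). *)
Definition h0 : nat :=
  \big[addn/0%N]_(u \in [set: 'rV[int]_d]) h0_deg u.

Definition chi_deg (u : 'rV[int]_d) : int :=
  \sum_(S in cones Sigma) (-1) ^+ codim S * (mrank M (sections S u))%:Z.

End Cohomology.
End Bundles.
End Toric.

(* Main.v *)
Require Import Defs.
From HB Require Import structures.
From mathcomp Require Import all_boot all_order all_algebra.
From mathcomp Require Import all_classical all_reals.
From mathcomp Require Import zify ring.
From mathcomp Require Import fintype finset.

Set Implicit Arguments.
Unset Strict Implicit.
Unset Printing Implicit Defensive.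

Import Order.TTheory GRing.Theory Num.Theory.
Local Open Scope ring_scope.

(** Let r_j be the coefficients of L on the rays v_j, and attach to a degree u
    and a power N the slacks s_j = <u, v_j> - N r_j. A ground element e is a
    section over the cone S exactly when s_j <= Phi(v_j)_e for all j in S. With
    c a bound for all the integers |Phi(v_j)_e|, a ray with s_j <= - c imposes
    nothing and a ray with s_j > c excludes every e. Only the levels between
    - c and c matter, and they do not move with N.

    Equality of chi and h0. The rank over S is zero if S has a ray with s_j > c,
    and otherwise depends only on tau, the set of the rays of S with
    - c < s_j <= c. Hence chi is the sum over tau of the rank over tau times the
    alternating number of cones S that contain tau and whose other rays all have
    s_j <= - c. For N large there is a convex piecewise linear function f that
    vanishes on tau and is positive exactly on those other rays, because N r
    dominates every bounded correction ([convex_perturb]). The alternating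
    number is then computed as in the Brianchon-Gram formula: a generic
    direction xi assigns to each cone S the unique full-dimensional cone that
    one enters when leaving the relative interior of S along xi
    ([sum_points_into]). Regrouping by that cone leaves alternating sums over
    intervals of subsets, which cancel unless the interval is a point
    ([euler_star_regroup]). If f is negative on some ray v_j, taking - xi close
    to v_j contradicts convexity in each surviving term, so the number is zero
    ([euler_star_neg]); if f is positive on all rays outside tau it is one
    ([euler_star_pos]). So tau contributes only when it is the set of all rays
    with s_j > - c and no ray has s_j > c, and then its rank is h0; that this set
    is a cone follows from strict convexity of r ([near_rays_cone]).

    Polynomiality. Consider the sums over u of G(s) for functions G that vanish
    when some s_j > c, do not distinguish values s_j <= - c, and vanish when
    s_j <= - c for some j in a given set tau. When tau is a cone, a lattice
    translation of u matches the slacks along tau for N and for N + 1; the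
    difference of the two sums then telescopes into sums of the same kind for
    the sets tau with one more ray ([slack_sum_diff]). When tau is not a cone
    the sum is zero for N large. Induction on the size of tau and discrete
    integration give a polynomial of degree at most d - |tau|
    ([slack_sum_polynomial]). For h0, where tau is empty, the degree is exactly
    d since the dilated polytope contains cubes with a number of lattice points
    of order N^d, all with s_j <= - c ([slack_sum_lower_bound]).

    Smoothness turns all of this into integer linear algebra: each cone has
    integral dual coordinates, so the argument runs over the lattice. *)

(** * Properties that hold for all large integers *)

Definition for_large (P : nat -> Prop) : Prop :=
  exists K0, forall K, (K0 <= K)%N -> P K.

Lemma for_large_mono (P Q : nat -> Prop) :
  (forall K, P K -> Q K) -> for_large P -> for_large Q.
Proof. by move=> PQ [K0 PK]; exists K0 => K /PK/PQ. Qed.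

Lemma for_large_and (P Q : nat -> Prop) :
  for_large P -> for_large Q -> for_large (fun K => P K /\ Q K).
Proof.
move=> [K1 P1] [K2 Q2]; exists (maxn K1 K2) => K; rewrite geq_max => /andP[h1 h2].
by split; [apply: P1 | apply: Q2].
Qed.

Lemma for_large_forall (T : finType) (P : T -> nat -> Prop) :
  (forall t, for_large (P t)) -> for_large (fun K => forall t, P t K).
Proof.
move=> evP; have [k kP] := choice evP.
exists (\max_t k t)%N => K leK t; apply: kP.
by apply: leq_trans leK; apply: leq_bigmax.
Qed.

Lemma for_large_imp (A : Prop) (P : nat -> Prop) :
  (A -> for_large P) -> for_large (fun K => A -> P K).
Proof.
move=> h; have [/h|nA] := pselect A; first exact: for_large_mono.
by exists 0%N.
Qed.

Lemma for_large_ltn k : for_large (fun K => (k < K)%N).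
Proof. by exists k.+1. Qed.

Lemma for_large_affine_gt0 (a b : int) : 0 < a -> for_large (fun K => 0 < a *+ K + b).
Proof.
move=> a0; exists (`|b|%N).+1 => K; rewrite -mulr_natr natz; nia.
Qed.

Lemma for_large_affine_neq0 (a b : int) :
  (a != 0) || (b != 0) -> for_large (fun K => a *+ K + b != 0).
Proof.
have [->|a0 _] := eqVneq a 0; first by exists 0%N => K _; rewrite mul0rn add0r.
exists (`|b|%N).+1 => K; rewrite -mulr_natr natz; nia.
Qed.

(** * The integral pairing and generic vectors *)

Section Pairing.
Variable d : nat.
Implicit Types u v : 'rV[int]_d.

Definition zdot u v : int := \sum_(i < d) u 0 i * v 0 i.

Lemma zdotC u v : zdot u v = zdot v u.
Proof. by apply: eq_bigr => i _; rewrite mulrC. Qed.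

Lemma zdotDr u v w : zdot u (v + w) = zdot u v + zdot u w.
Proof. by rewrite -big_split; apply: eq_bigr => i _; rewrite mxE mulrDr. Qed.

Lemma zdotZr u a v : zdot u (a *: v) = a * zdot u v.
Proof. by rewrite mulr_sumr; apply: eq_bigr => i _; rewrite mxE mulrCA. Qed.

Lemma zdot0r u : zdot u 0 = 0.
Proof. by apply: big1 => i _; rewrite mxE mulr0. Qed.

Lemma zdotNr u v : zdot u (- v) = - zdot u v.
Proof. by rewrite -scaleN1r zdotZr mulN1r. Qed.

Lemma zdotMnr u v K : zdot u (v *+ K) = zdot u v *+ K.
Proof. by rewrite -scaler_nat zdotZr mulr_natl. Qed.

Lemma zdot_sumr (I : finType) (A : {pred I}) u (F : I -> 'rV[int]_d) :
  zdot u (\sum_(i in A) F i) = \sum_(i in A) zdot u (F i).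
Proof. exact: (big_morph (zdot u) (zdotDr u) (zdot0r u)). Qed.

Lemma zdot_suml (I : finType) (A : {pred I}) u (F : I -> 'rV[int]_d) :
  zdot (\sum_(i in A) F i) u = \sum_(i in A) zdot (F i) u.
Proof. by rewrite zdotC zdot_sumr; apply: eq_bigr => i _; rewrite zdotC. Qed.

Lemma zdotDl u v w : zdot (v + w) u = zdot v u + zdot w u.
Proof. by rewrite zdotC zdotDr !(zdotC u). Qed.

Lemma zdotMnl u v K : zdot (v *+ K) u = zdot v u *+ K.
Proof. by rewrite zdotC zdotMnr zdotC. Qed.

Lemma zdotZl u a v : zdot (a *: v) u = a * zdot v u.
Proof. by rewrite zdotC zdotZr zdotC. Qed.

Lemma zdot_self_neq0 u : u != 0 -> zdot u u != 0.
Proof.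
apply: contraNN; rewrite psumr_eq0 => [/allP u0|i _]; last by rewrite -expr2 sqr_ge0.
apply/eqP/rowP => i; rewrite mxE; apply/eqP.
by have := u0 i (mem_index_enum i); rewrite mulf_eq0 orbb.
Qed.

(** A vector missed by the hyperplanes treated so far, scaled up, stays off
    them after adding the normal of the next one. *)
Lemma avoid_hyperplanes (s : seq 'rV[int]_d) :
  (forall l, l \in s -> l != 0) -> exists x, forall l, l \in s -> zdot l x != 0.
Proof.
elim: s => [|l s IHs] s0; first by exists 0.
have [x xs] : exists x, forall l, l \in s -> zdot l x != 0.
  by apply: IHs => k ks; apply: s0; rewrite inE ks orbT.
have [lx0|lx] := eqVneq (zdot l x) 0; last first.
  by exists x => k; rewrite inE => /orP[/eqP->|/xs].
have : for_large (fun K => forall t : 'I_(size s), zdot s`_t x *+ K + zdot s`_t l != 0).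
  by apply: for_large_forall => t; apply: for_large_affine_neq0; rewrite xs ?mem_nth.
move=> [K /(_ K (leqnn K)) KP]; exists (x *+ K + l) => k.
rewrite inE zdotDr zdotMnr => /orP[/eqP->|ks].
  by rewrite lx0 mul0rn add0r zdot_self_neq0 // s0 // mem_head.
have ik : (index k s < size s)%N by rewrite index_mem.
by have := KP (Ordinal ik); rewrite /= nth_index.
Qed.

End Pairing.

(** * Lattice form of a smooth complete fan *)

(** The integral data that the rest of the proof uses of a smooth complete fan.
    For a cone S, [ldual S] gives the coordinates of S: it is the part indexed by
    S of the basis dual to a lattice basis through the rays of S, and [lsep S]
    is a nonzero form vanishing on S, which exists when S is not
    full-dimensional. [lmeet] says that a point of the relative interior of S
    lies in T only if S is a face of T. *)
Record lattice_fan (d n : nat) := LatticeFan {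
  lray : 'I_n -> 'rV[int]_d;
  lcones : {set {set 'I_n}};
  ldual : {set 'I_n} -> 'I_n -> 'rV[int]_d;
  lsep : {set 'I_n} -> 'rV[int]_d;
  lcones_sub : forall S T : {set 'I_n}, T \in lcones -> S \subset T -> S \in lcones;
  lcones1 : forall i, [set i]%SET \in lcones;
  lcones_card : forall S, S \in lcones -> (#|S| <= d)%N;
  ldualE : forall S, S \in lcones ->
    {in S &, forall i j, zdot (ldual S i) (lray j) = (i == j)%:R};
  ldual_basis : forall S, S \in lcones -> #|S| = d ->
    forall x, x = \sum_(i in S) zdot (ldual S i) x *: lray i;
  lsep_neq0 : forall S, S \in lcones -> (#|S| < d)%N -> lsep S != 0;
  lsep_orth : forall S, S \in lcones -> (#|S| < d)%N ->
    forall i, i \in S -> zdot (lsep S) (lray i) = 0;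
  lcomplete : forall x, exists2 S, S \in lcones &
    exists2 a : 'I_n -> int, (forall i, i \in S -> 0 <= a i) &
      x = \sum_(i in S) a i *: lray i;
  lmeet : forall S T (a b : 'I_n -> int), S \in lcones -> T \in lcones ->
    (forall i, i \in S -> 0 < a i) -> (forall i, i \in T -> 0 <= b i) ->
    \sum_(i in S) a i *: lray i = \sum_(i in T) b i *: lray i -> S \subset T
}.

(** * Generic directions and the full cone entered from a cone *)

Section LatticeFan.
Variables (d n : nat) (F : lattice_fan d n).
Local Notation v := (lray F).
Local Notation cones := (lcones F).
Implicit Types (S T tau : {set 'I_n}) (x xi : 'rV[int]_d) (f : 'I_n -> int).

Definition coordz T x i : int := zdot (ldual F T i) x.
Definition full_cone T : bool := (T \in cones) && (#|T| == d).

(** The hyperplane [lsep T] contains the span of T, so a generic vector lies in the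
    span of full-dimensional cones only. *)
Definition generic xi := forall T, T \in cones -> (#|T| < d)%N -> zdot (lsep F T) xi != 0.

Definition barycenter S : 'rV[int]_d := \sum_(i in S) v i.

(** T is the full-dimensional cone entered by moving a little along [xi] from
    the relative interior of S. *)
Definition points_into S xi T : bool :=
  [&& full_cone T, S \subset T & [forall i in T :\: S, 0 < coordz T xi i]].

Lemma full_cone_in T : full_cone T -> T \in cones. Proof. by case/andP. Qed.
Lemma full_cone_card T : full_cone T -> #|T| = d. Proof. by case/andP => _ /eqP. Qed.

Lemma coordz_ray T i j : T \in cones -> i \in T -> j \in T -> coordz T (v j) i = (i == j)%:R.
Proof. by move=> TF iT jT; rewrite /coordz ldualE. Qed.

Lemma coordzD T x y i : coordz T (x + y) i = coordz T x i + coordz T y i. Proof. exact: zdotDr. Qed.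
Lemma coordzMn T x K i : coordz T (x *+ K) i = coordz T x i *+ K. Proof. exact: zdotMnr. Qed.
Lemma coordzN T x i : coordz T (- x) i = - coordz T x i. Proof. exact: zdotNr. Qed.

Lemma coordz_barycenter S T i : T \in cones -> S \subset T -> i \in T ->
  coordz T (barycenter S) i = (i \in S)%:R.
Proof.
move=> TF ST iT; rewrite /coordz zdot_sumr.
rewrite (eq_bigr (fun j => (i == j)%:R)) => [|j jS]; last first.
  by rewrite ldualE // (subsetP ST).
have [iS|niS] := boolP (i \in S).
  rewrite (bigD1 i) //= eqxx big1 ?addr0 // => j /andP[_ /negPf].
  by rewrite eq_sym => ->.
by rewrite big1 // => j jS; case: eqP => // ij; rewrite ij jS in niS.
Qed.

Lemma coordz_expand T x : full_cone T -> x = \sum_(i in T) coordz T x i *: v i.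
Proof. by case/andP => TF /eqP Td; apply: ldual_basis. Qed.

Lemma generic_exists : exists xi, generic xi.
Proof.
pose s := [seq lsep F T | T <- enum cones & (#|T| < d)%N].
have [|xi xiP] := @avoid_hyperplanes d s.
  move=> l /mapP[T]; rewrite mem_filter mem_enum => /andP[Td TF] ->.
  exact: lsep_neq0.
exists xi => T TF Td; apply/xiP/mapP; exists T => //.
by rewrite mem_filter mem_enum Td.
Qed.

Lemma generic_shift x xi : generic xi -> for_large (fun K => generic (x *+ K + xi)).
Proof.
move=> gxi.
have : for_large (fun K => forall T, (T \in cones) && (#|T| < d)%N ->
    zdot (lsep F T) (x *+ K + xi) != 0).
  apply: for_large_forall => T; apply: for_large_imp => /andP[TF Td].
  apply: (for_large_mono _ (@for_large_affine_neq0 (zdot (lsep F T) x) (zdot (lsep F T) xi) _)).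
    by move=> K; rewrite zdotDr zdotMnr.
  by rewrite gxi ?orbT.
by apply: for_large_mono => K h T TF Td; apply: h; rewrite TF.
Qed.

Lemma genericN xi : generic xi -> generic (- xi).
Proof. by move=> gxi T TF Td; rewrite zdotNr oppr_eq0 gxi. Qed.

Lemma generic_full_cone xi T (a : 'I_n -> int) : generic xi -> T \in cones ->
  xi = \sum_(i in T) a i *: v i -> full_cone T.
Proof.
move=> gxi TF xiE; rewrite /full_cone TF eqn_leq (lcones_card TF) /= leqNgt.
apply/negP => Td; have /eqP[] := gxi T TF Td.
rewrite xiE zdot_sumr big1 // => i iT.
by rewrite zdotZr lsep_orth // mulr0.
Qed.

Lemma coordz_lincomb T (a : 'I_n -> int) i : T \in cones -> i \in T ->
  coordz T (\sum_(j in T) a j *: v j) i = a i.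
Proof.
move=> TF iT; rewrite /coordz zdot_sumr (bigD1 i) //= zdotZr ldualE // eqxx mulr1.
rewrite big1 ?addr0 // => j /andP[jT /negPf ji].
by rewrite zdotZr ldualE // eq_sym ji mulr0.
Qed.

Lemma generic_coordz_neq0 xi T i : generic xi -> full_cone T -> i \in T -> coordz T xi i != 0.
Proof.
move=> gxi tT iT; apply/eqP => c0.
have TF := full_cone_in tT.
have T'F : T :\ i \in cones by apply: lcones_sub TF (subsetDl _ _).
have T'd : (#|T :\ i| < d)%N by rewrite -(full_cone_card tT) (cardsD1 i T) iT.
have/eqP[] := gxi _ T'F T'd.
rewrite (coordz_expand xi tT) (bigD1 i) //= c0 scale0r add0r.
rewrite (eq_bigl (mem (T :\ i))) => [|j]; last by rewrite !inE andbC.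
rewrite zdot_sumr big1 // => j jT.
by rewrite zdotZr lsep_orth // mulr0.
Qed.

(** Uniqueness of the cone entered: for K large, [xi] plus K times the
    barycenter of S is interior to T and to T'. *)
Lemma points_into_sub S xi T T' : points_into S xi T -> points_into S xi T' -> T \subset T'.
Proof.
case/and3P=> tT ST /'forall_implyP Tp; case/and3P=> tT' ST' /'forall_implyP Tp'.
have pos U : full_cone U -> S \subset U -> (forall i, i \in U :\: S -> 0 < coordz U xi i) ->
    for_large (fun K => forall i, i \in U -> 0 < coordz U (barycenter S *+ K + xi) i).
  move=> tU SU Up; apply: for_large_forall => i; apply: for_large_imp => iU.
  have [iS|niS] := boolP (i \in S).
    apply: for_large_mono (for_large_affine_gt0 (coordz U xi i) ltr01) => K.
    by rewrite coordzD coordzMn coordz_barycenter ?full_cone_in // iS.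
  exists 0%N => K _; rewrite coordzD coordzMn coordz_barycenter ?full_cone_in //.
  by rewrite (negPf niS) mul0rn add0r Up // inE niS.
have [K /(_ K (leqnn K)) [pT pT']] := for_large_and (pos T tT ST Tp) (pos T' tT' ST' Tp').
apply: (lmeet (a := coordz T (barycenter S *+ K + xi))
              (b := coordz T' (barycenter S *+ K + xi))).
- exact: full_cone_in.
- exact: full_cone_in.
- exact: pT.
- by move=> i /pT' /ltW.
- by rewrite -!coordz_expand.
Qed.

(** The points [xi] plus K times the barycenter of S are generic for K large, so
    each lies in a full-dimensional cone; finitely many cones are available, so
    one of them occurs for arbitrarily large K, and it contains the barycenter
    as a limit direction. *)
Lemma points_into_exists S xi : S \in cones -> generic xi -> exists T, points_into S xi T.
Proof.
move=> SF gxi; have [K0 gK] := generic_shift (barycenter S) gxi.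
have [T [tT Tinf]] : exists T, full_cone T /\ forall K1, exists2 K, (K1 <= K)%N &
    forall i, i \in T -> 0 <= coordz T (barycenter S *+ K + xi) i.
  apply/not_existsP => h.
  have [k kP] : for_large (fun K => forall T, full_cone T ->
      ~ forall i, i \in T -> 0 <= coordz T (barycenter S *+ K + xi) i).
    apply: for_large_forall => T; apply: for_large_imp => tT; apply: contrapT => nev.
    apply: (h T); split=> // K1; apply: contrapT => nK; apply: nev.
    by exists K1 => K leK Kp; apply: nK; exists K.
  have [T TF [a a0 aE]] := lcomplete F (barycenter S *+ (maxn K0 k) + xi).
  have tT : full_cone T by apply: generic_full_cone TF aE; apply: gK; rewrite leq_maxl.
  apply: (kP (maxn K0 k) (leq_maxr _ _) T tT) => i iT.
  by rewrite aE coordz_lincomb ?a0.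
have TF := full_cone_in tT.
have bar0 i : i \in T -> 0 <= coordz T (barycenter S) i.
  move=> iT; have [//|neg] := lerP 0 (coordz T (barycenter S) i).
  have [K1 K1P] := @for_large_affine_gt0 (- coordz T (barycenter S) i) (- coordz T xi i) ltac:(lia).
  have [K leK /(_ i iT)] := Tinf K1; have := K1P K leK.
  rewrite coordzD coordzMn mulNrn; lia.
have ST : S \subset T.
  apply: (lmeet (a := fun=> 1) SF TF _ bar0) => //.
  by rewrite -coordz_expand //; apply: eq_bigr => i _; rewrite scale1r.
exists T; apply/and3P; split=> //; apply/'forall_implyP => i /setDP[iT niS].
rewrite lt0r generic_coordz_neq0 //=.
have [K _ /(_ i iT)] := Tinf 0%N.
by rewrite coordzD coordzMn coordz_barycenter // (negPf niS) mul0rn add0r.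
Qed.

Lemma sum_points_into S xi : S \in cones -> generic xi ->
  \sum_(T | points_into S xi T) 1%R = 1%R :> int.
Proof.
move=> SF gxi; have [T pT] := points_into_exists SF gxi.
rewrite (bigD1 T) //= big1 ?addr0 // => T' /andP[pT' /eqP[]].
by apply/eqP; rewrite eqEsubset !(points_into_sub pT, points_into_sub pT').
Qed.

End LatticeFan.

(** * Alternating sums over cones *)

(** Toggling an element of B outside A is a sign-reversing involution. *)
Lemma sum_interval0 n d (A B : {set 'I_n}) : A != B -> (#|B| <= d)%N ->
  \sum_(S : {set 'I_n} | (A \subset S) && (S \subset B)) (-1) ^+ (d - #|S|) = 0%R :> int.
Proof.
move=> AB Bd; have [sAB|nAB] := boolP (A \subset B); last first.
  rewrite big_pred0 // => S; apply: contraNF nAB => /andP[]; exact: subset_trans.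
have /subsetPn[b bB bA] : ~~ (B \subset A).
  by apply: contra AB => sBA; rewrite eqEsubset sAB.
rewrite (bigID (fun S : {set 'I_n} => b \in S)) /=.
rewrite [X in _ + X](reindex_onto (fun S => S :\ b) (fun S => b |: S)) /=; last first.
  by move=> S /andP[_ bS]; rewrite setU1K.
rewrite [X in _ + X](eq_bigl (fun S : {set 'I_n} =>
  ((A \subset S) && (S \subset B)) && (b \in S))); last first.
  move=> S; rewrite setD11 andbT.
  have -> : (b |: S :\ b == S) = (b \in S).
    by apply/eqP/idP => [<-|bS]; [rewrite setU11 | rewrite setD1K].
  have [bS|] := boolP (b \in S); rewrite ?andbF // !andbT.
  rewrite subsetD1 bA andbT subDset (setUidPr _) ?sub1set //.
rewrite -big_split big1 //= => S /andP[/andP[AS SB] bS].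
have := subset_leq_card SB; rewrite (cardsD1 b S) bS => leS.
rewrite -[(d - #|S :\ b|)%N]subSS -[(1 + _)%N]/(#|S :\ b|.+1) subSn; last first.
  exact: leq_trans leS Bd.
by rewrite exprS; ring.
Qed.

Section Euler.
Variables (d n : nat) (F : lattice_fan d n).
Local Notation v := (lray F).
Local Notation cones := (lcones F).
Implicit Types (S T tau : {set 'I_n}) (x xi : 'rV[int]_d) (f r : 'I_n -> int).

(** The linear function that agrees with [f] on the rays of the full cone T. *)
Definition lin_ext f T x : int := \sum_(i in T) coordz F T x i * f i.
(** Convexity of the piecewise linear function with values [f] on the rays, read
    off on rays only: a convex piecewise linear function is the maximum of its
    linear pieces. *)
Definition convex f := forall T j, full_cone F T -> lin_ext f T (v j) <= f j.
Definition strictly_convex f :=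
  forall T j, full_cone F T -> j \notin T -> lin_ext f T (v j) < f j.

Lemma lin_ext_ray f T j : full_cone F T -> j \in T -> lin_ext f T (v j) = f j.
Proof.
move=> tT jT; rewrite /lin_ext (bigD1 j) //= coordz_ray ?full_cone_in // eqxx mul1r.
rewrite big1 ?addr0 // => i /andP[iT /negPf ij].
by rewrite coordz_ray ?full_cone_in // ij mul0r.
Qed.

Lemma lin_ext_lincomb f T (U : {set 'I_n}) (a : 'I_n -> int) :
  lin_ext f T (\sum_(j in U) a j *: v j) = \sum_(j in U) a j * lin_ext f T (v j).
Proof.
rewrite /lin_ext; under eq_bigr do rewrite /coordz zdot_sumr mulr_suml.
rewrite exchange_big; apply: eq_bigr => j _ /=; rewrite mulr_sumr.
by apply: eq_bigr => i _; rewrite zdotZr mulrA.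
Qed.

(** Grouping the cones S by the full cone T that they point into: given T, the
    admissible S form an interval of subsets of T, from the rays that S must
    contain (those of tau, and those where the coordinate of [xi] is not positive)
    to the rays that S may contain. *)
Lemma euler_star_regroup tau f xi : tau \in cones -> generic F xi ->
  \sum_(S in cones | (tau \subset S) && [forall i in S :\: tau, 0 < f i])
     (-1) ^+ (d - #|S|)
  = \sum_(T | full_cone F T && (tau \subset T))
      \sum_(S : {set 'I_n} |
         ([set i in T | (i \in tau) || (coordz F T xi i <= 0)] \subset S) &&
         (S \subset [set i in T | (i \in tau) || (0 < f i)]))
        (-1) ^+ (d - #|S|) :> int.
Proof.
move=> tauF gxi.
transitivity (\sum_(S in cones | (tau \subset S) && [forall i in S :\: tau, 0 < f i])
  \sum_(T | points_into F S xi T) ((-1) ^+ (d - #|S|)) : int).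
  apply: eq_bigr => S /andP[SF _].
  by rewrite -[LHS]mul1r -(sum_points_into SF gxi) mulr_suml; under eq_bigr do rewrite mul1r.
rewrite (exchange_big_dep (fun T => full_cone F T && (tau \subset T))) /=; last first.
  move=> S T /andP[_ /andP[tauS _]] /and3P[-> ST _] /=.
  exact: subset_trans ST.
apply: eq_bigr => T /andP[tT tauT]; apply: eq_bigl => S.
apply/idP/idP.
  case/andP => /andP[SF /andP[tauS /'forall_implyP Sf]] /and3P[_ ST /'forall_implyP Sp].
  apply/andP; split; apply/subsetP => i; rewrite inE.
    case/andP => iT /orP[/(subsetP tauS)//|]; apply: contraTT => niS.
    by rewrite -ltNge Sp // inE niS.
  move=> iS; rewrite (subsetP ST) //=.
  by case: (boolP (i \in tau)) => //= nit; rewrite Sf // inE nit.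
case/andP => lo hi.
have ST : S \subset T.
  by apply/subsetP => i /(subsetP hi); rewrite inE => /andP[].
have tauS : tau \subset S.
  apply/subsetP => i it; apply: (subsetP lo).
  by rewrite inE it (subsetP tauT).
rewrite (lcones_sub (full_cone_in tT) ST) tauS /points_into tT ST /=.
apply/andP; split; apply/'forall_implyP => i; rewrite inE => /andP[ni iS].
  by have := subsetP hi _ iS; rewrite inE (negPf ni) => /andP[].
rewrite ltNge; apply: contra ni => c0.
by apply: (subsetP lo); rewrite inE iS c0 orbT.
Qed.

(** With all rays admissible, T survives the cancellation exactly when tau points
    into T along [- xi], which happens for one T, and then only S = T is left. *)
Lemma euler_star_pos tau : tau \in cones ->
  \sum_(S in cones | tau \subset S) (-1) ^+ (d - #|S|) = 1%R :> int.
Proof.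
move=> tauF; have [xi gxi] := generic_exists F.
have := @euler_star_regroup tau (fun=> 1) xi tauF gxi.
rewrite (eq_bigl (fun S => (S \in cones) && (tau \subset S))); last first.
  by move=> S; congr andb; rewrite (_ : [forall i in _, _] = true) ?andbT //; apply/'forall_implyP.
move=> ->; rewrite -[RHS](sum_points_into tauF (genericN gxi)) 
  (bigID (points_into F tau (- xi))) /=.
rewrite [X in _ + X]big1 ?addr0 => [|T /andP[/andP[tT tauT]]]; last first.
  rewrite /points_into tT tauT /= negb_forall_in => /exists_inP[i]; rewrite inE => /andP[nit iT].
  rewrite coordzN oppr_gt0 -leNgt => c0.
  apply: sum_interval0; last first.
    by rewrite -(full_cone_card tT) subset_leq_card //; apply/subsetP => j; rewrite inE => /andP[].
  apply/eqP => /setP/(_ i); rewrite !inE iT ltr01 orbT (negPf nit) /=.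
  by rewrite leNgt lt0r c0 generic_coordz_neq0.
apply: eq_big => T; first by rewrite /points_into; case: (full_cone F T) (tau \subset T) => [] [].
case/andP => /andP[tT tauT] /and3P[_ _ /'forall_implyP cpos].
rewrite (eq_bigl (pred1 T)) ?big_pred1_eq ?(full_cone_card tT) ?subnn // => S /=.
have -> : [set i in T | (i \in tau) || (coordz F T xi i <= 0)] = T.
  apply/setP => i; rewrite inE; case: (boolP (i \in T)) => //= iT.
  case: (boolP (i \in tau)) => //= nit.
  by have := cpos i; rewrite inE nit iT coordzN oppr_gt0 => /(_ isT)/ltW.
have -> : [set i in T | (i \in tau) || (0 < 1%R :> int)] = T.
  by apply/setP => i; rewrite inE ltr01 orbT andbT.
by rewrite eq_sym eqEsubset.
Qed.

(** The generic direction is [- xi] with [xi] near [v j], where the piecewise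
    linear function is negative. By convexity every linear piece is negative at
    [xi]. But in a surviving T no coordinate of [xi] has the sign opposite to [f]
    on the corresponding ray, so the linear piece of T is nonnegative at [xi]. *)
Lemma euler_star_neg tau f j : tau \in cones -> convex f ->
  {in tau, forall i, f i = 0} -> f j < 0 ->
  \sum_(S in cones | (tau \subset S) && [forall i in S :\: tau, 0 < f i])
     (-1) ^+ (d - #|S|) = 0%R :> int.
Proof.
move=> tauF fconv f0 fj; have [eta geta] := generic_exists F.
have jF := lcones1 F j.
have [U /and3P[tU jU /'forall_implyP Up]] := points_into_exists jF geta.
rewrite sub1set in jU.
have coK K i : i \in U -> coordz F U (v j *+ K + eta) i = (i == j)%:R *+ K + coordz F U eta i.
  by move=> iU; rewrite coordzD coordzMn coordz_ray ?full_cone_in.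
have ev1 := for_large_affine_gt0 (coordz F U eta j) ltr01.
have ev2 := @for_large_affine_gt0 (- f j) (- lin_ext f U eta) ltac:(lia).
have [K /(_ K (leqnn K)) [gK [cj fK]]] :=
  for_large_and (generic_shift (v j) geta) (for_large_and ev1 ev2).
set xi := v j *+ K + eta in gK.
have xipos i : i \in U -> 0 <= coordz F U xi i.
  move=> iU; rewrite coK //; have [->|ij] := eqVneq i j; first exact: ltW.
  by rewrite mul0rn add0r ltW // Up // !inE ij.
have lin_neg : lin_ext f U xi < 0.
  have -> : lin_ext f U xi = f j *+ K + lin_ext f U eta.
    rewrite -(lin_ext_ray f tU jU) /lin_ext -sumrMnl -big_split /=.
    by apply: eq_bigr => i iU; rewrite coK // coordz_ray ?full_cone_in // mulrDl mulrnAl.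
  by move: fK; rewrite mulNrn; lia.
rewrite (euler_star_regroup f tauF (genericN gK)) big1 // => T /andP[tT tauT].
apply: sum_interval0; last first.
  by rewrite -(full_cone_card tT) subset_leq_card //; apply/subsetP => i; rewrite inE => /andP[].
apply/eqP => /setP same.
have : 0 <= lin_ext f T xi.
  apply: sumr_ge0 => i iT; have := same i; rewrite !inE iT coordzN oppr_le0 /=.
  case: (boolP (i \in tau)) => [it _|_ /= E]; first by rewrite f0 // mulr0.
  case: (lerP 0 (coordz F T xi i)) E => [c0 /esym fi|c0 /esym/negbT].
    by rewrite mulr_ge0 // ltW.
  by rewrite -leNgt => fi; rewrite mulr_le0 // ltW.
rewrite leNgt => /negP[]; apply: le_lt_trans lin_neg.
rewrite {1}(coordz_expand xi tU) lin_ext_lincomb; apply: ler_sum => i iU.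
by rewrite ler_wpM2l ?xipos // fconv.
Qed.

(** Each cone lies in a full-dimensional one, so the full cones cover the
    lattice. *)
Lemma full_cone_cover x : exists2 T, full_cone F T & forall i, i \in T -> 0 <= coordz F T x i.
Proof.
have [S SF [a a0 ->]] := lcomplete F x.
have [xi gxi] := generic_exists F.
have [T /and3P[tT ST _]] := points_into_exists SF gxi; exists T => // i iT.
rewrite /coordz zdot_sumr; apply: sumr_ge0 => j jS.
by rewrite zdotZr mulr_ge0 ?a0 // ldualE ?full_cone_in ?(subsetP ST _ jS) ?ler0n.
Qed.

(** * Comparison of chi and h0 *)

(** The rays on which u is close to the boundary of the polytope of N r, when u
    is not far outside of it, span a cone. Otherwise let T be a full cone
    containing the barycenter of these rays: expressing the barycenter in T and
    comparing the two values of the slack produces a defect of N times the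
    convexity gap of [r], while both values are bounded by a multiple of [c]. *)
Lemma near_rays_cone r (c : int) : strictly_convex r -> 0 <= c ->
  for_large (fun N => forall tau (s : 'I_n -> int) u,
    (forall j, s j = zdot u (v j) - r j *+ N) -> (forall j, s j <= c) ->
    (forall j, j \in tau -> - c <= s j) -> tau \in cones).
Proof.
move=> rconv c0; apply: for_large_forall => tau.
have [T tT a0] := full_cone_cover (barycenter F tau).
set a := coordz F T _ in a0; have aE : barycenter F tau = \sum_(i in T) a i *: v i.
  exact: coordz_expand.
have TF := full_cone_in tT.
exists `|(c * (#|tau|%:Z + \sum_(i in T) a i))%R|%N.+1 => N leN s u sE sc stau.
apply: (lcones_sub TF); apply/negP => /negP/subsetPn[j jtau jT].
have sumE : \sum_(i in tau) s i - \sum_(i in T) a i * s i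
    = - (\sum_(i in tau) (r i - lin_ext r T (v i))) *+ N.
  have -> : \sum_(i in T) a i * s i = \sum_(i in tau) lin_ext s T (v i).
    transitivity (lin_ext s T (barycenter F tau)); last first.
      rewrite /barycenter (_ : \sum_(i in tau) v i = \sum_(i in tau) 1%:Z *: v i).
        by rewrite lin_ext_lincomb; under eq_bigr do rewrite mul1r.
      by apply: eq_bigr => i _; rewrite scale1r.
    rewrite aE lin_ext_lincomb; apply: eq_bigr => i iT.
    by rewrite lin_ext_ray.
  rewrite -sumrB -sumrN -sumrMnl; apply: eq_bigr => i _.
  have -> : lin_ext s T (v i) = zdot u (v i) - lin_ext r T (v i) *+ N.
    rewrite {2}(coordz_expand (v i) tT) zdot_sumr /lin_ext -sumrMnl -sumrB.
    by apply: eq_bigr => k kT; rewrite zdotZr sE mulrBr -mulrnAr.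
  by rewrite sE mulNrn mulrnBl; ring.
have gap : 1 <= \sum_(i in tau) (r i - lin_ext r T (v i)).
  have ge0 i : 0 <= r i - lin_ext r T (v i).
    have [iT|niT] := boolP (i \in T); first by rewrite lin_ext_ray ?subrr.
    by rewrite subr_ge0 ltW // rconv.
  rewrite (bigD1 j) //=; have := rconv T j tT jT.
  have : 0 <= \sum_(i in tau | i != j) (r i - lin_ext r T (v i)) by apply: sumr_ge0.
  by move: (bigop _ _ _) (lin_ext _ _ _) => ? ?; lia.
have low1 : - c *+ #|tau| <= \sum_(i in tau) s i.
  by rewrite -sumr_const ler_sum.
have low2 : \sum_(i in T) a i * s i <= c * \sum_(i in T) a i.
  by rewrite mulr_sumr ler_sum // => i iT; rewrite mulrC ler_wpM2r ?a0.
have : N%:Z <= (\sum_(i in tau) (r i - lin_ext r T (v i))) *+ N.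
  by rewrite -[X in X <= _]natz lerMn2r gap orbT.
move: sumE low1 low2 leN; rewrite !mulNrn -[c *+ _]mulr_natr natz mulrDr.
move: (\sum_(i in tau) s i) (\sum_(i in T) a i * s i) (_ *+ N).
move: (c * \sum_(i in T) a i) (c * _) => p q x y z; lia.
Qed.

(** The integral gaps of a strictly convex [r] are at least 1, so those of N r
    absorb any bounded perturbation; a linear function does not change them. *)
Lemma convex_perturb r (c : int) : strictly_convex r -> 0 <= c ->
  for_large (fun N => forall f u, (forall j, `|f j - (r j *+ N - zdot u (v j))| <= c) ->
    convex f).
Proof.
move=> rconv c0.
have evT : for_large (fun N => forall T j, full_cone F T && (j \notin T) ->
    c * (1 + \sum_(i in T) `|coordz F T (v j) i|) < N%:Z).
  apply: for_large_forall => T; apply: for_large_forall => j; apply: for_large_imp => _.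
  by exists `|(c * (1 + \sum_(i in T) `|coordz F T (v j) i|))%R|%N.+1 => K; lia.
apply: for_large_mono evT => N bigN f u fE T j tT.
have [jT|jT] := boolP (j \in T); first by rewrite lin_ext_ray.
set g := fun i => r i *+ N - zdot u (v i).
have gE : lin_ext g T (v j) = lin_ext r T (v j) *+ N - zdot u (v j).
  rewrite {3}(coordz_expand (v j) tT) zdot_sumr /lin_ext -sumrMnl -sumrB.
  by apply: eq_bigr => k kT; rewrite zdotZr mulrBr -mulrnAr.
have fg : lin_ext f T (v j) - lin_ext g T (v j) <=
    c * \sum_(i in T) `|coordz F T (v j) i|.
  rewrite -sumrB mulr_sumr ler_sum // => i iT; rewrite -mulrBr.
  apply: le_trans (ler_norm _) _; rewrite normrM mulrC.
  by rewrite ler_wpM2r ?fE.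
have := bigN T j; rewrite tT jT => /(_ isT); have := rconv T j tT jT.
have := fE j.
move: fg; rewrite gE mulrDr mulr1.
move: (c * \sum_(i in T) _) (lin_ext f T (v j)) (lin_ext r T (v j)) (zdot u (v j)).
move=> p x y z h1 h2 h3 h4.
have : N%:Z <= (r j - y) *+ N.
  by rewrite -[X in X <= _]natz lerMn2r; apply/orP; right; lia.
by rewrite mulrnBl; lia.
Qed.

(** The comparison of chi and h0 for any function [rk] on sets of rays that
    reacts to slacks like the rank of the sections: it vanishes on sets with a
    ray of slack above [c], and ignores rays of slack at most [- c]. *)
Lemma euler_rank r (c : int) : strictly_convex r -> 0 <= c ->
  for_large (fun N => forall u (s : 'I_n -> int) (rk : {set 'I_n} -> int),
    (forall j, s j = zdot u (v j) - r j *+ N) ->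
    (forall S j, j \in S -> c < s j -> rk S = 0) ->
    (forall S, rk S = rk (S :&: [set j | - c < s j])) ->
    \sum_(S in cones) (-1) ^+ (d - #|S|) * rk S = rk [set: 'I_n]%SET).
Proof.
move=> rconv c0.
have c1 : 0 <= 2 * c + 1 by lia.
have r2conv : strictly_convex (fun j => 2 * r j).
  move=> T j tT jT; have -> : lin_ext (fun j => 2 * r j) T (v j) = 2 * lin_ext r T (v j).
    by rewrite /lin_ext mulr_sumr; apply: eq_bigr => i _; rewrite mulrCA.
  by rewrite ltr_pM2l // rconv.
apply: for_large_mono (for_large_and (near_rays_cone rconv c0) (convex_perturb r2conv c1)).
move=> N [small conv] u s rk sE rk0 rkI.
set Z := [set j | - c < s j & s j <= c].
have rkZ S : (forall j, j \in S -> s j <= c) -> rk S = rk (S :&: Z).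
  move=> Sc; rewrite rkI; congr rk; apply/setP => j; rewrite !inE.
  by case: (boolP (j \in S)) => //= /Sc ->; rewrite andbT.
pose coef tau := \sum_(S in cones |
  (tau \subset S) && [forall i in S :\: tau, s i <= - c]) ((-1) ^+ (d - #|S|)) : int.
have -> : \sum_(S in cones) (-1) ^+ (d - #|S|) * rk S =
    \sum_(tau in cones | tau \subset Z) rk tau * coef tau.
  rewrite (bigID (fun S : {set 'I_n} => [forall j in S, s j <= c])) /=.
  rewrite [X in _ + X]big1 ?addr0 => [|S /andP[SF]]; last first.
    rewrite negb_forall_in => /exists_inP[j jS].
    by rewrite -ltNge => /(rk0 _ _ jS) ->; rewrite mulr0.
  rewrite (partition_big (fun S => S :&: Z) (fun tau => (tau \in cones) && (tau \subset Z))) /=.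
    apply: eq_bigr => tau /andP[tauF tauZ]; rewrite mulr_sumr.
    apply: eq_big => S; last first.
      by case/andP => /andP[_ /'forall_implyP Sc] /eqP <-; rewrite mulrC -rkZ.
    rewrite -andbA; congr andb; apply/idP/idP.
      case/andP => /'forall_implyP Sc /eqP <-; rewrite subsetIl /=.
      apply/'forall_implyP => i; rewrite !inE => /andP[+ iS].
      by rewrite iS Sc //= andbT -leNgt.
    case/andP => tauS /'forall_implyP Sp; apply/andP; split.
      apply/'forall_implyP => j jS; have [jt|jt] := boolP (j \in tau).
        by have := subsetP tauZ _ jt; rewrite inE => /andP[].
      have := Sp j; rewrite inE jt jS => /(_ isT); lia.
    apply/eqP/setP => j; rewrite inE; have [jt|jt] := boolP (j \in tau).
      by rewrite (subsetP tauS) // (subsetP tauZ).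
    have [jS|//] := boolP (j \in S); have := Sp j; rewrite !inE jt jS /= => /(_ isT).
    by rewrite leNgt => /negPf ->.
  by move=> S /andP[SF _]; rewrite subsetIr (lcones_sub SF (subsetIl _ _)).
have coef0 tau j : tau \in cones -> tau \subset Z -> j \notin tau ->
    - c < s j -> coef tau = 0.
  move=> tauF tauZ jt sj.
  (* The support function is doubled so that the threshold - c + 1/2 for the
     slack, where f changes sign off tau, becomes integral and is never met. *)
  pose f i := if i \in tau then 0 else - (2 * s i) - (2 * c - 1).
  have fconv : convex f.
    apply: (conv f (u *+ 2)) => i.
    have -> : 2 * r i *+ N - zdot (u *+ 2) (v i) = - (2 * s i).
      by rewrite sE zdotMnl mulrBr opprB mulrnAr [2 * zdot _ _]mulr_natl.
    rewrite /f; case: ifP => [it|_].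
      have := subsetP tauZ i it; rewrite inE sub0r opprK.
      by move: (s i) => z; lia.
    by move: (s i) => z; lia.
  rewrite -(@euler_star_neg tau f j tauF fconv) /f.
  - apply: eq_bigl => S; congr andb; congr andb.
    apply: eq_forallb => i; rewrite inE; case: (boolP (i \in tau)) => //= it.
    by congr implb; lia.
  - by move=> i ->.
  - by rewrite (negPf jt); lia.
have [/existsP[j sj]|] := boolP [exists j, c < s j].
  rewrite (rk0 _ j) ?in_setT // big1 // => tau /andP[tauF tauZ].
  rewrite (coef0 tau j) ?mulr0 //; last by lia.
  by apply/negP => /(subsetP tauZ); rewrite inE; lia.
rewrite negb_exists => /forallP sc.
have {}sc j : s j <= c by have := sc j; rewrite -leNgt.
have ZF : Z \in cones.
  by apply: (small Z s u) => // j; rewrite inE => /andP[/ltW].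
rewrite (bigD1 Z) ?ZF /= ?subxx // big1 ?addr0; last first.
  move=> tau /andP[/andP[tauF tauZ] tauNZ].
  have /subsetPn[j jZ jt] : ~~ (Z \subset tau).
    by apply: contra tauNZ => Zt; rewrite eqEsubset tauZ.
  by rewrite (coef0 tau j) ?mulr0 //; move: jZ; rewrite inE => /andP[].
rewrite [RHS]rkZ // setTI; transitivity (rk Z * 1); last exact: mulr1.
congr (_ * _); rewrite -(euler_star_pos ZF); apply: eq_bigl => S.
congr andb; rewrite [X in _ && X](_ : _ = true) ?andbT //.
by apply/'forall_implyP => i; rewrite !inE sc andbT leNgt => /andP[].
Qed.

End Euler.

(** * From smooth complete fans to lattice fans *)

Section Bridge.
Variables (R : realType) (d n : nat) (Sigma : complete_fan R d n).
Hypothesis smoothS : smooth Sigma.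
Local Notation ry := (ray Sigma).
Local Notation gc := (@gen_cone R d n (ray Sigma)).
Implicit Types (S T : {set 'I_n}).

Lemma pairing_emb (u x : 'rV[int]_d) : pairing (emb R u) (emb R x) = (zdot u x)%:~R.
Proof.
by rewrite rmorph_sum; apply: eq_bigr => i _; rewrite !mxE rmorphM.
Qed.

Lemma pairing_lincomb (I : finType) (P : pred I) (y : 'rV[R]_d) (a : I -> R)
    (w : I -> 'rV[R]_d) :
  pairing y (\sum_(i | P i) a i *: w i) = \sum_(i | P i) a i * pairing y (w i).
Proof.
rewrite /pairing; under eq_bigr do rewrite summxE mulr_sumr.
rewrite exchange_big; apply: eq_bigr => i _ /=; rewrite mulr_sumr.
by apply: eq_bigr => k _; rewrite !mxE mulrCA.
Qed.

Lemma pairing_suml (S : {set 'I_n}) (w : 'I_n -> 'rV[R]_d) (x : 'rV[R]_d) :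
  pairing (\sum_(i in S) w i) x = \sum_(i in S) pairing (w i) x.
Proof.
rewrite /pairing exchange_big; apply: eq_bigr => k _ /=.
by rewrite summxE mulr_suml.
Qed.

Lemma emb_inj k : injective (@emb R k).
Proof. by move=> u x /matrixP E; apply/matrixP => i j; have := E i j; rewrite !mxE => /intr_inj. Qed.

Lemma emb_lincomb (S : {set 'I_n}) (a : 'I_n -> int) (w : 'I_n -> 'rV[int]_d) :
  emb R (\sum_(i in S) a i *: w i) = \sum_(i in S) (a i)%:~R *: emb R (w i).
Proof. by rewrite /emb raddf_sum; apply: eq_bigr => i _; rewrite /= map_mxZ. Qed.

Lemma gen_cone_ray S i : i \in S -> gc S (emb R (ry i)).
Proof.
move=> iS; exists (fun j => (j == i)%:R) => [j|]; first exact: ler0n.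
rewrite (bigD1 i) //= eqxx scale1r big1 ?addr0 // => j /andP[_ /negPf->].
by rewrite scale0r.
Qed.

Lemma gen_cone_lincomb S T (a : 'I_n -> R) : (forall i, i \in T -> 0 <= a i) ->
  (forall i, i \in T -> gc S (emb R (ry i))) ->
  gc S (\sum_(i in T) a i *: emb R (ry i)).
Proof.
move=> a0 TS; apply: (big_ind (gc S)).
- by exists (fun=> 0) => // ; rewrite big1 // => i _; rewrite scale0r.
- move=> x y [b b0 ->] [c c0 ->]; exists (fun i => b i + c i).
    by move=> i; rewrite addr_ge0.
  by rewrite -big_split; apply: eq_bigr => i _; rewrite scalerDl.
- move=> i iT; have [b b0 ->] := TS i iT; exists (fun j => a i * b j).
    by move=> j; rewrite mulr_ge0 // a0.
  by rewrite scaler_sumr; apply: eq_bigr => j _; rewrite scalerA.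
Qed.

Lemma gen_cone_sub S T : (forall i, i \in T -> gc S (emb R (ry i))) ->
  forall x, gc T x -> gc S x.
Proof. by move=> TS x [a a0 ->]; apply: gen_cone_lincomb. Qed.

(** A ray contained in a cone is one of its faces, hence one of its rays. *)
Lemma ray_in_cone S i : S \in cones Sigma -> gc S (emb R (ry i)) -> i \in S.
Proof.
move=> SF Si; apply/(fan_rays SF).
have := fan_meet SF (fan_ray_in Sigma i).
suff -> : (gc S `&` gc [set i])%classic = gc [set i] by [].
apply/seteqP; split=> x; first by case.
move=> ix; split=> //; apply: gen_cone_sub ix => j.
by rewrite inE => /eqP ->.
Qed.

(** The first component is the family [ldual S], the second is [lsep S]. *)
Definition dual_frame S (p : ('I_n -> 'rV[int]_d) * 'rV[int]_d) : Prop :=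
  [/\ (#|S| <= d)%N,
      {in S &, forall i j, zdot (p.1 i) (ry j) = (i == j)%:R},
      #|S| = d -> forall x, x = \sum_(i in S) zdot (p.1 i) x *: ry i &
      (#|S| < d)%N -> p.2 != 0 /\ forall i, i \in S -> zdot p.2 (ry i) = 0].

(** Both come from the columns of the inverse of the unimodular matrix whose rows
    include the rays of S: those indexed by S, and any other one. *)
Lemma smooth_dual_frame S : S \in cones Sigma -> exists p, dual_frame S p.
Proof.
move=> SF; have [A [f [uA injf fA]]] := smoothS SF.
pose w k : 'rV[int]_d := (col k (invmx A))^T.
have ipw k x : zdot (w k) x = (x *m invmx A) 0 k.
  by rewrite mxE; apply: eq_bigr => i _; rewrite !mxE mulrC.
have wray k j : j \in S -> zdot (w k) (ry j) = (k == f j)%:R.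
  by move=> jS; rewrite ipw -fA // -row_mul mulmxV // row1 mxE eqxx.
have cardf : #|f @: S| = #|S| by apply: card_in_imset.
have leSd : (#|S| <= d)%N by rewrite -cardf -[X in (_ <= X)%N]card_ord max_card.
have [Sd|Sd] := eqVneq #|S| d.
  exists (fun i => w (f i), 0); split=> //=.
  - by move=> i j iS jS; rewrite wray // (inj_in_eq injf).
  - move=> _ x; rewrite -{1}[x](mulmxKV uA) mulmx_sum_row.
    have fS : f @: S = [set: 'I_d].
      by apply/eqP; rewrite eqEcard subsetT cardsT card_ord cardf Sd /=.
    rewrite (eq_bigl (fun k => k \in f @: S)) => [|k]; last by rewrite fS inE.
    rewrite big_imset //=; apply: eq_bigr => i iS.
    by rewrite fA // ipw.
  - by rewrite Sd ltnn.
have /subsetPn[k _ kS] : ~~ ([set: 'I_d] \subset f @: S).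
  apply: contra Sd => /subset_leq_card.
  by rewrite cardsT card_ord cardf eqn_leq leSd.
exists (fun i => w (f i), w k); split=> //=.
- by move=> i j iS jS; rewrite wray // (inj_in_eq injf).
- by move=> Sd'; rewrite Sd' eqxx in Sd.
move=> _; split.
  apply/negP => /eqP wk0; have := congr1 (fun u : 'rV_d => zdot u (row k A)) wk0.
  rewrite ipw -row_mul mulmxV // row1 mxE !eqxx /= zdotC zdot0r.
  by move/eqP; rewrite oner_eq0.
move=> i iS; rewrite wray //; case: eqP => // ki.
by rewrite ki imset_f in kS.
Qed.

(** In a smooth cone T, the sum of the dual vectors of the rays outside S is a
    supporting form whose face is spanned by S, so subsets of cones are cones. A
    supporting form that cuts out the intersection of S and T and vanishes at an
    interior point of S vanishes on S, which gives [lmeet]. Integrality of the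
    coordinates holds because they are values of the dual vectors. *)
Lemma lattice_fan_of_smooth : exists F : lattice_fan d n,
  lray F = ray Sigma /\ lcones F = cones Sigma.
Proof.
have exframe S : exists p, S \in cones Sigma -> dual_frame S p.
  have [SF|SF] := boolP (S \in cones Sigma); last by exists (fun=> 0, 0).
  by have [q qP] := smooth_dual_frame SF; exists q.
have {exframe}[p pP] := choice exframe.
have coef S (a : 'I_n -> R) i : S \in cones Sigma -> i \in S ->
    pairing (emb R ((p S).1 i)) (\sum_(j in S) a j *: emb R (ry j)) = a i.
  move=> SF iS; have [_ dualE _ _] := pP S SF.
  rewrite pairing_lincomb (bigD1 i) //= pairing_emb dualE // eqxx mulr1.
  rewrite big1 ?addr0 // => j /andP[jS /negPf ji].
  by rewrite pairing_emb dualE // eq_sym ji mulr0.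
have cones_sub S T : T \in cones Sigma -> S \subset T -> S \in cones Sigma.
  move=> TF ST; have [_ dualE _ _] := pP T TF.
  have gcST x : gc S x -> gc T x.
    by apply: gen_cone_sub => i iS; apply: gen_cone_ray; apply: (subsetP ST).
  have [U UF UE] : exists2 U, U \in cones Sigma & gc S = gc U.
    apply: (fan_face TF).
    exists (\sum_(i in T :\: S) emb R ((p T).1 i)).
    have val a : pairing (\sum_(i in T :\: S) emb R ((p T).1 i))
        (\sum_(j in T) a j *: emb R (ry j)) = \sum_(i in T :\: S) a i.
      by rewrite pairing_suml; apply: eq_bigr => i /setDP[iT _]; rewrite coef.
    split; first by move=> x [a a0 ->]; rewrite val sumr_ge0.
    apply/seteqP; split=> x.
      move=> Sx; split; first exact: gcST.
      case: Sx => a a0 ->; rewrite pairing_lincomb big1 // => j jS.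
      rewrite pairing_suml big1 ?mulr0 // => i /setDP[iT iS].
      rewrite pairing_emb dualE ?(subsetP ST _ jS) //.
      by case: eqP => // ij; rewrite ij jS in iS.
    case=> -[a a0 ->]; rewrite val => /eqP; rewrite psumr_eq0 // => /allP aTS.
    rewrite (big_setID S) /= (setIidPr ST) addrC big1 ?add0r.
      by exists a.
    move=> i iTS; have := aTS i (mem_index_enum i).
    by rewrite iTS /= => /eqP ->; rewrite scale0r.
  suff -> : S = U by [].
  apply/setP => i; apply/idP/idP => [iS|iU].
    by apply: (ray_in_cone UF); rewrite -UE; apply: gen_cone_ray.
  have Si : gc S (emb R (ry i)) by rewrite UE; apply: gen_cone_ray.
  have iT : i \in T by apply: (ray_in_cone TF); apply: gcST.
  apply: contraT => niS; case: Si => a a0 iE.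
  have := congr1 (pairing (emb R ((p T).1 i))) iE.
  rewrite pairing_emb dualE // eqxx pairing_lincomb big1.
    by move/eqP; rewrite oner_eq0.
  move=> j jS; rewrite pairing_emb dualE ?(subsetP ST _ jS) //.
  by case: eqP => [ij|_]; [rewrite ij jS in niS | rewrite mulr0].
have disj S T (a b : 'I_n -> int) : S \in cones Sigma -> T \in cones Sigma ->
    (forall i, i \in S -> 0 < a i) -> (forall i, i \in T -> 0 <= b i) ->
    \sum_(i in S) a i *: ry i = \sum_(i in T) b i *: ry i -> S \subset T.
  move=> SF TF a0 b0 abE.
  have [y [y0 yE]] := fan_meet SF TF.
  have xS : gc S (emb R (\sum_(i in S) a i *: ry i)).
    rewrite emb_lincomb; apply: gen_cone_lincomb => i iS; last exact: gen_cone_ray.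
    by rewrite ler0z ltW // a0.
  have xT : gc T (emb R (\sum_(i in S) a i *: ry i)).
    rewrite abE emb_lincomb; apply: gen_cone_lincomb => i iT; last exact: gen_cone_ray.
    by rewrite ler0z b0.
  have : (gc S `&` gc T)%classic (emb R (\sum_(i in S) a i *: ry i)) by [].
  rewrite yE emb_lincomb => -[_]; rewrite pairing_lincomb => /eqP.
  rewrite psumr_eq0 => [/allP ay0|i iS]; last first.
    by rewrite mulr_ge0 ?y0 ?ler0z ?ltW ?a0 //; apply: gen_cone_ray.
  apply/subsetP => i iS; apply: (ray_in_cone TF).
  suff : (gc S `&` gc T)%classic (emb R (ry i)) by case.
  rewrite yE; split; first exact: gen_cone_ray.
  have := ay0 i (mem_index_enum i); rewrite iS /= mulf_eq0 intr_eq0.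
  by rewrite gt_eqF ?a0 //= => /eqP.
have complete x : exists2 S, S \in cones Sigma &
    exists2 a : 'I_n -> int, (forall i, i \in S -> 0 <= a i) &
      x = \sum_(i in S) a i *: ry i.
  have [S SF [a a0 xE]] := fan_complete Sigma (emb R x).
  have aE i : i \in S -> a i = (zdot ((p S).1 i) x)%:~R.
    by move=> iS; rewrite -pairing_emb xE coef.
  exists S => //; exists (fun i => zdot ((p S).1 i) x).
    by move=> i iS; have := a0 i; rewrite aE // ler0z.
  apply: emb_inj; rewrite emb_lincomb xE; apply: eq_bigr => i iS.
  by rewrite aE.
unshelve eexists (@LatticeFan d n ry (cones Sigma) (fun S => (p S).1)
  (fun S => (p S).2) cones_sub (fan_ray_in Sigma) _ _ _ _ _ complete disj).
- by move=> S /pP[].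
- by move=> S /pP[].
- by move=> S /pP[].
- by move=> S /pP[_ _ _ sep] /sep[].
- by move=> S /pP[_ _ _ sep] /sep[].
by [].
Qed.

Lemma codim_card (F : lattice_fan d n) S :
  lray F = ray Sigma -> lcones F = cones Sigma ->
  S \in cones Sigma -> codim Sigma S = (d - #|S|)%N.
Proof.
move=> rE cE SF; rewrite -cE in SF; congr (_ - _)%N.
set X := [seq _ | i in S].
have sX : size X = #|S| by rewrite size_map -cardE.
suff /eqP -> : free X by [].
rewrite -[X]/(tval (in_tuple X)); apply/freeP => k kE i.
have iX : (i < #|S|)%N by rewrite -sX.
pose j0 := enum_val (Ordinal iX).
have nthX j : (j < #|S|)%N -> X`_j = emb R (ry (nth j0 (enum S) j)).
  by move=> jS; rewrite (nth_map j0) // -cardE.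
have mem j : (j < #|S|)%N -> nth j0 (enum S) j \in S.
  by move=> jS; rewrite -mem_enum mem_nth // -cardE.
have := congr1 (pairing (emb R (ldual F S (nth j0 (enum S) i)))) kE.
have pr0 (y : 'rV[R]_d) : pairing y 0 = 0 :> R by apply: big1 => l _; rewrite mxE mulr0.
rewrite pr0 pairing_lincomb.
rewrite (bigD1 i) //= nthX // pairing_emb -rE ldualE ?mem // eqxx mulr1.
rewrite big1 ?addr0 // => j ji; have jX : (j < #|S|)%N by rewrite -sX.
rewrite nthX // pairing_emb -rE ldualE ?mem //.
rewrite nth_uniq ?enum_uniq -?cardE //.
by rewrite eq_sym (_ : (j == i :> nat) = false) ?mulr0 //; apply: negPf.
Qed.

(** The face G of the polytope with normal cone T consists of points where all
    inequalities of T are tight; as T is full-dimensional they all take the value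
    [lin_ext F (lcoef L) T] on the rays. If this value were [lcoef L j] for some
    j outside T, the ray j would be in the normal cone of G. *)
Lemma ample_strictly_convex (F : lattice_fan d n) (L : line_bundle Sigma) :
  lray F = ray Sigma -> lcones F = cones Sigma ->
  ample L -> strictly_convex F (lcoef L).
Proof.
move=> rE cE [fanE facet] T j tT jT.
have TF : T \in cones Sigma by rewrite -cE; apply: full_cone_in.
pose P := lpolytope L.
have faceOf S : S \in cones Sigma -> exists2 G, poly_face P G & fcone Sigma S = normal_cone P G.
  move=> SF.
  have : [set K | exists2 S0, S0 \in cones Sigma & K = fcone Sigma S0]%classic
    (fcone Sigma S).
    by exists S.
  by rewrite -fanE.
have maxray i : exists2 z, P z & pairing z (emb R (ry i)) = (lcoef L i)%:~R.
  have [G faceG GE] := faceOf _ (fan_ray_in Sigma i).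
  have [[z Gz] [x xE]] := faceG; exists z; first by move: Gz; rewrite xE => -[].
  by apply: (facet i G).
have [G faceG GE] := faceOf _ TF.
have Gray y i : G y -> i \in T -> pairing y (emb R (ry i)) = (lcoef L i)%:~R.
  move=> Gy iT; have : fcone Sigma T (emb R (ry i)) by apply: gen_cone_ray.
  rewrite GE => /(_ y Gy)[Py ymax]; apply/eqP; rewrite eq_le Py /=.
  by have [z Pz <-] := maxray i; apply: ymax.
have Glin y : G y -> pairing y (emb R (ry j)) = (lin_ext F (lcoef L) T (lray F j))%:~R.
  move=> Gy; rewrite -rE {1}(coordz_expand (lray F j) tT) emb_lincomb pairing_lincomb.
  rewrite rmorph_sum; apply: eq_bigr => i iT.
  by rewrite rE Gray // -rmorphM.
have [[y Gy] [x xE]] := faceG.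
have Py : P y by move: Gy; rewrite xE => -[].
have := Py j; rewrite Glin // ler_int le_eqVlt => /orP[/eqP lE|//].
suff : j \in T by rewrite (negPf jT).
apply: (ray_in_cone TF).
have -> : gen_cone ry T = normal_cone P G by [].
move=> z Gz; have Pz : P z by move: Gz; rewrite xE => -[].
by split=> // q Pq; rewrite (Glin z) // lE.
Qed.

End Bridge.

(** * Discrete integration of integer-valued polynomials *)

Section EventuallyPolynomial.
Implicit Types (P Q : {poly rat}) (D : nat) (g : nat -> int).

Definition fallpoly D : {poly rat} := \prod_(i < D) ('X - (i%:R)%:P).

Lemma size_fallpoly D : size (fallpoly D) = D.+1.
Proof. by rewrite size_prod_XsubC -[RHS]addn1 -[index_enum _]enumT size_enum_ord addn1. Qed.

Lemma fallpoly_monic D : fallpoly D \is monic.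
Proof. exact: monic_prod_XsubC. Qed.

Lemma fallpoly_diff D :
  fallpoly D.+1 \Po ('X + 1) - fallpoly D.+1 = D.+1%:R *: fallpoly D.
Proof.
have -> : fallpoly D.+1 \Po ('X + 1) = ('X + 1) * fallpoly D.
  rewrite /fallpoly rmorph_prod big_ord_recl /= rmorphB /= comp_polyX comp_polyC subr0.
  congr (_ * _); apply: eq_bigr => i _.
  rewrite rmorphB /= comp_polyX comp_polyC /bump leq0n add1n.
  by rewrite -natr1 polyCD; ring.
rewrite {2}/fallpoly big_ord_recr /= -/(fallpoly D) -mul_polyC -natr1 polyCD; ring.
Qed.

(** Falling factorials are a basis of the polynomials, and their differences are
    again falling factorials up to scalars. *)
Lemma antidifference D Q : (size Q <= D)%N ->
  exists P, [/\ (size P <= D.+1)%N, P \Po ('X + 1) - P = Q & P.[0] = 0].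
Proof.
elim: D Q => [|D IHD] Q sQ.
  exists 0; split; rewrite ?size_poly0 ?horner0 // comp_poly0 subr0.
  by apply/esym/eqP; rewrite -size_poly_leq0.
have ffD : (fallpoly D)`_D = 1.
  by have /monicP := fallpoly_monic D; rewrite lead_coefE size_fallpoly.
have [|P [sP dP P0]] := IHD (Q - Q`_D *: fallpoly D).
  apply/leq_sizeP => j; rewrite leq_eqVlt => /orP[/eqP<-|Dj].
    by rewrite coefB coefZ ffD mulr1 subrr.
  rewrite coefB coefZ [Q`_j]nth_default ?(leq_trans sQ Dj) //.
  by rewrite [_`_j]nth_default ?size_fallpoly // mulr0 subr0.
exists (P + (Q`_D / D.+1%:R) *: fallpoly D.+1); split.
- rewrite (leq_trans (size_polyD _ _)) // geq_max (leq_trans sP) //=.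
  by rewrite (leq_trans (size_scale_leq _ _)) // size_fallpoly.
- rewrite comp_polyD comp_polyZ opprD addrACA dP -scalerBr fallpoly_diff scalerA.
  by rewrite divfK ?pnatr_eq0 // subrK.
- by rewrite hornerD hornerZ P0 /fallpoly big_ord_recl hornerM hornerXsubC subrr mul0r mulr0 addr0.
Qed.

Definition eventually_poly D g := exists P, [/\ (size P <= D)%N,
  forall k : int, P.[k%:~R] \is a Num.int & for_large (fun N => P.[N%:R] = (g N)%:~R)].

Lemma eventually_poly0 D g : for_large (fun N => g N = 0) -> eventually_poly D g.
Proof.
move=> g0; exists 0; split; first by rewrite size_poly0.
  by move=> k; rewrite horner0.
by apply: for_large_mono g0 => N ->; rewrite horner0.
Qed.

Lemma eventually_polyD D g h :
  eventually_poly D g -> eventually_poly D h -> eventually_poly D (fun N => g N + h N).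
Proof.
move=> [P [sP iP gP]] [Q [sQ iQ hQ]]; exists (P + Q); split.
- by rewrite (leq_trans (size_polyD _ _)) // geq_max sP.
- by move=> k; rewrite hornerD rpredD.
by apply: for_large_mono (for_large_and gP hQ) => N [gE hE]; rewrite hornerD gE hE rmorphD.
Qed.

Lemma eventually_poly_sum D (I : finType) (A : pred I) (g : I -> nat -> int) :
  (forall i, A i -> eventually_poly D (g i)) -> eventually_poly D (fun N => \sum_(i | A i) g i N).
Proof.
move=> gP; have : forall s : seq I, eventually_poly D (fun N => \sum_(i <- s | A i) g i N).
  elim=> [|i s IHs]; first by apply: eventually_poly0; exists 0%N => N _; rewrite big_nil.
  have [Ai|Ai] := boolP (A i).
    have [P [sP iP hP]] := eventually_polyD (gP i Ai) IHs; exists P; split=> //.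
    by apply: for_large_mono hP => N ->; rewrite big_cons Ai.
  have [P [sP iP hP]] := IHs; exists P; split=> //.
  by apply: for_large_mono hP => N ->; rewrite big_cons (negPf Ai).
by apply.
Qed.

(** Normalised to vanish at 0, the antidifference of an integer-valued polynomial
    is integer-valued by telescoping, and adjusting it to [g] costs an integer
    constant. *)
Lemma eventually_poly_diff D g :
  eventually_poly D (fun N => g N.+1 - g N) -> eventually_poly D.+1 g.
Proof.
move=> [Q [sQ iQ [N0 QE]]]; have [P [sP dP P0]] := antidifference sQ.
have step (x : rat) : P.[x + 1] = P.[x] + Q.[x].
  by rewrite -dP hornerD hornerN horner_comp hornerD hornerX hornerC; ring.
have iP (k : int) : P.[k%:~R] \is a Num.int.
  elim/int_rec: k => [|k IHk|k IHk]; first by rewrite P0.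
    by rewrite -addn1 PoszD rmorphD /= step rpredD.
  have := step (- (k.+1%:Z))%:~R; rewrite -addn1 PoszD opprD rmorphD /= subrK => E.
  by rewrite -(rpredDr _ (iQ (- k%:Z - 1))) rmorphD /= -E.
have [c cE] : exists c : int, P.[N0%:R] = c%:~R by apply/intrP; have := iP N0.
exists (P + (g N0 - c)%:~R%:P); split.
- rewrite (leq_trans (size_polyD _ _)) // geq_max sP.
  exact: leq_trans (size_polyC_leq1 _) _.
- by move=> k; rewrite hornerD hornerC rpredD // intr_int.
exists N0 => N; elim: N => [|N IHN].
  by rewrite leqn0 => /eqP N00; rewrite hornerD hornerC -N00 cE rmorphB /=; ring.
rewrite leq_eqVlt => /orP[/eqP <-|leN].
  by rewrite hornerD hornerC cE rmorphB /=; ring.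
have := QE N leN; have := IHN leN.
rewrite -natr1 !hornerD !hornerC step rmorphB /= => E ->.
by rewrite addrAC E; ring.
Qed.

(** The factor N on the left makes the bound uniform in D, including D = 0. *)
Lemma poly_growth D P : (size P <= D)%N ->
  exists A : rat, forall N, (0 < N)%N -> N%:R * P.[N%:R] <= A * N%:R ^+ D.
Proof.
move=> sP; exists (\sum_(i < D) `|P`_i|) => N N0.
rewrite (horner_coef_wide _ sP) mulr_sumr mulr_suml ler_sum // => i _.
rewrite mulrCA -exprS; apply: le_trans (ler_norm _) _.
rewrite normrM ler_wpM2l // ger0_norm ?exprn_ge0 ?ler0n //.
by rewrite ler_weXn2l ?ler1n.
Qed.

End EventuallyPolynomial.

(** * Sums over lattice points of functions of the slacks *)

Section LatticePointSums.
Variables (d n : nat) (F : lattice_fan d n) (r : 'I_n -> int).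
Hypothesis rconv : strictly_convex F r.
Local Notation v := (lray F).
Local Notation cones := (lcones F).
Implicit Types (s : 'I_n -> int) (G : ('I_n -> int) -> int) (tau : {set 'I_n}).
Implicit Types (c : int) (N : nat).

Definition slack N (u : 'rV[int]_d) : 'I_n -> int := fun j => zdot u (v j) - r j *+ N.

Definition slack_sum G N : int :=
  (\sum_(u \in [set: 'rV[int]_d]%classic) G (slack N u))%R.

(** The functions of the slacks that see only the levels between [- c] and [c],
    and are supported near the facets of the rays in tau. The rank of the
    sections is one for empty tau; nonempty sets tau arise from differences. *)
Definition clamped c tau G : Prop :=
  [/\ 0 <= c,
      forall s j, c < s j -> G s = 0,
      forall s s', (forall j, s j = s' j \/ (s j <= - c /\ s' j <= - c)) -> G s = G s' &
      forall s j, j \in tau -> s j <= - c -> G s = 0].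

(** By completeness each coordinate vector and its opposite are nonnegative
    combinations of rays, so the inequalities bound the coordinates of u. *)
Lemma halfspaces_finite (a : 'I_n -> int) :
  exists2 p : seq 'rV[int]_d, uniq p & forall u, u \notin p -> exists j, a j < zdot u (v j).
Proof.
have bound x : exists b : int, forall u, (forall j, zdot u (v j) <= a j) -> zdot u x <= b.
  have [S SF [k k0 ->]] := lcomplete F x.
  exists (\sum_(i in S) k i * a i) => u ua; rewrite zdot_sumr ler_sum // => i iS.
  by rewrite zdotZr ler_wpM2l ?k0.
have {bound}[b bP] := choice bound.
pose e i : 'rV[int]_d := delta_mx 0 i.
have ipe u i : zdot u (e i) = u 0 i.
  rewrite /zdot (bigD1 i) //= mxE !eqxx mulr1 big1 ?addr0 // => k /negPf ki.
  by rewrite mxE ki andbF mulr0.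
pose B := (\sum_i (`|b (e i)| + `|b (- e i)|))%N.
have bound u i : (forall j, zdot u (v j) <= a j) -> `|u 0 i| <= B%:Z.
  move=> ua; have h1 := bP (e i) u ua; have h2 := bP (- e i) u ua.
  have : (`|b (e i)| + `|b (- e i)| <= B)%N by rewrite /B (bigD1 i) //= leq_addr.
  move: h1 h2; rewrite zdotNr ipe; lia.
pose pt (t : {ffun 'I_d -> 'I_(B + B).+1}) : 'rV[int]_d := \row_i ((t i)%:Z - B%:Z).
exists (undup [seq pt t | t <- enum {ffun 'I_d -> 'I_(B + B).+1}]).
  exact: undup_uniq.
move=> u; apply: contraPP => /forallNP ua; apply/negP; rewrite negbK mem_undup.
have {}ua j : zdot u (v j) <= a j by rewrite leNgt; apply/negP; apply: ua.
apply/mapP; exists [ffun i => inord (absz (u 0 i + B%:Z))]; first by rewrite mem_enum.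
apply/rowP => i; rewrite mxE ffunE; have := bound u i ua => ub.
rewrite inordK; move: (u 0 i) (B) ub => z k ub; lia.
Qed.

Lemma slack_support c N : exists2 p : seq 'rV[int]_d, uniq p &
  forall u, u \notin p -> exists j, c < slack N u j.
Proof.
have [p up pP] := halfspaces_finite (fun j => c + r j *+ N).
exists p => // u /pP[j uj]; exists j; rewrite /slack; lia.
Qed.

Lemma fsum_seq (T : choiceType) (p : seq T) (H : T -> int) : uniq p ->
  (forall u, u \notin p -> H u = 0) ->
  (\sum_(u \in [set: T]%classic) H u)%R = \sum_(u <- p) H u.
Proof.
move=> up Hp; rewrite (fsbigE p) //; last by move=> u _; apply: Hp.
by apply: eq_bigl => u; rewrite mem_set.
Qed.

(** Translating u by [u0], whose pairing with the rays in tau is [r], turns the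
    change from N to N + 1 into a shift of the slacks by [r'], which vanishes on
    tau. The shift is done one ray at a time; shifting the slack of the ray k
    only matters where that slack is near the window, so the difference is
    clamped along k as well, for a wider window. *)
Lemma slack_sum_diff c tau G : tau \in cones -> clamped c tau G ->
  exists c' (H : 'I_n -> ('I_n -> int) -> int),
    (forall k, k \notin tau -> clamped c' (k |: tau) (H k)) /\
    forall N, slack_sum G N.+1 - slack_sum G N = \sum_(k | k \notin tau) slack_sum (H k) N.
Proof.
move=> tauF [c0 G0 Gcl Gtau].
pose u0 := \sum_(i in tau) r i *: ldual F tau i.
pose r' j := r j - zdot u0 (v j).
have r'0 j : j \in tau -> r' j = 0.
  move=> jt; rewrite /r' zdot_suml (bigD1 j) //= zdotZl ldualE // eqxx mulr1.
  rewrite big1 ?addr0 ?subrr // => i /andP[it /negPf ij].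
  by rewrite zdotZl ldualE // ij mulr0.
(* The shift restricted to the first k rays. *)
pose part (k : nat) (j : 'I_n) := if (j < k)%N then r' j else 0.
pose C : int := \sum_j `|r' j|.
have C0 : 0 <= C by apply: sumr_ge0.
have partC k j : `|part k j| <= C.
  rewrite /part; case: ifP => _; last by rewrite normr0.
  by rewrite /C (bigD1 j) //= lerDl sumr_ge0.
pose H (k : 'I_n) s := G (fun j => s j - part k.+1 j) - G (fun j => s j - part k j).
have H0 s j k : c + C < s j -> G (fun j => s j - part k j) = 0.
  by move=> sj; apply: (G0 _ j); have := partC k j; lia.
exists (c + C), H; split.
  move=> k kt; split.
  - by lia.
  - by move=> s j sj; rewrite /H !(H0 _ j) ?subrr.
  - move=> s s' ss'; rewrite /H; congr (_ - _); apply: Gcl => j.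
      by have := partC k.+1 j; case: (ss' j) => [->|[h1 h2]]; [left|right; lia].
    by have := partC k j; case: (ss' j) => [->|[h1 h2]]; [left|right; lia].
  - move=> s j; rewrite !inE => /orP[/eqP -> sk|jt sj].
      rewrite /H [X in X - _](_ : _ = G (fun j => s j - part k j)) ?subrr //.
      apply: Gcl => i; have [->|ik] := eqVneq i k.
        by right; have := partC k.+1 k; have := partC k k; lia.
      left; rewrite /part ltnS leq_eqVlt.
      by rewrite (_ : (i == k :> nat) = false) //; apply: negPf.
    rewrite /H !(Gtau _ j) ?subrr //.
      by have := partC k j; lia.
    by have := partC k.+1 j; lia.
move=> N; have [p up pP] := slack_support (c + C) N.
have toseq G' : (forall s j, c + C < s j -> G' s = 0) ->
    slack_sum G' N = \sum_(u <- p) G' (slack N u).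
  by move=> G'0; apply: fsum_seq => // u /pP[j]; apply: G'0.
have -> : slack_sum G N.+1 = slack_sum (fun s => G (fun j => s j - part n j)) N.
  rewrite /slack_sum (reindex_fsbigT (fun u => u + u0)) /=; last first.
    by exists (fun u => u - u0) => u; rewrite (addrK, subrK).
  apply: eq_fsbigr => u _; apply: Gcl => j; left.
  by rewrite /slack /part ltn_ord /r' zdotDl mulrS; lia.
have -> : slack_sum G N = slack_sum (fun s => G (fun j => s j - part 0%N j)) N.
  by apply: eq_fsbigr => u _; apply: Gcl => j; left; rewrite /part subr0.
rewrite !toseq; last 2 first.
- by move=> s j; apply: H0.
- by move=> s j; apply: H0.
rewrite [RHS](eq_bigr (fun k => \sum_(u <- p) H k (slack N u))); last first.
  by move=> k _; apply: toseq => s j sj; rewrite /H !(H0 _ j) ?subrr.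
rewrite exchange_big -sumrB; apply: eq_bigr => u _ /=.
rewrite -(telescope_sumr (fun k => G (fun j => slack N u j - part k j)) (leq0n n)).
rewrite big_mkord [RHS]big_mkcond /=; apply: eq_bigr => k _.
case: ifPn => //; rewrite negbK => kt; apply/eqP; rewrite subr_eq0; apply/eqP.
apply: Gcl => j; left; rewrite /part ltnS leq_eqVlt.
have [->|jk] := eqVneq j k; first by rewrite eqxx ltnn r'0.
by rewrite (_ : (j == k :> nat) = false) //; apply: negPf.
Qed.

(** If tau is not a cone then no lattice point contributes for N large. If it is
    one, the difference in N is a sum of terms with one more ray in tau. *)
Lemma slack_sum_polynomial c tau G :
  clamped c tau G -> eventually_poly (d.+1 - #|tau|) (slack_sum G).
Proof.
(* Sets with more than n rays do not exist, so the induction starts there. *)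
move: {2}(n.+1 - #|tau|)%N (leqnn (n.+1 - #|tau|)) => m.
elim: m c tau G => [|m IHm] c tau G.
  have taun : (#|tau| <= n)%N by rewrite -[X in (_ <= X)%N]card_ord max_card.
  by rewrite subSn.
move=> lem clampedG; have [tauF|tauF] := boolP (tau \in cones); last first.
  apply: eventually_poly0; have [c0 G0 _ Gtau] := clampedG.
  apply: for_large_mono (near_rays_cone rconv c0) => N small; apply: fsbig1 => u _.
  apply: contrapT => Gn0; move/negP: tauF; apply.
  apply: (small tau (slack N u) u) => // j.
    by rewrite leNgt; apply/negP => /G0.
  by move=> jt; rewrite ltW // ltNge; apply/negP => /(Gtau _ _ jt).
rewrite subSn ?(lcones_card tauF) //; apply: eventually_poly_diff.
have [c' [H [admH stepE]]] := slack_sum_diff tauF clampedG.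
have [P [sP iP PE]] : eventually_poly (d - #|tau|)
    (fun N => \sum_(k | k \notin tau) slack_sum (H k) N).
  apply: eventually_poly_sum => k kt.
  have := IHm c' (k |: tau) (H k); rewrite cardsU1 kt => /(_ _ (admH k kt)).
  by rewrite -subSS add1n; apply; lia.
by exists P; split=> //; apply: for_large_mono PE => N ->; rewrite stepE.
Qed.

(** The sum of the vertices of the polytope: the inequality of a ray j is strict
    at the vertex of a full cone containing [- v j], since that cone omits j. *)
Lemma interior_point : exists (y : 'rV[int]_d) (q : nat), (0 < q)%N /\
  forall j, zdot y (v j) + 1 <= r j *+ q.
Proof.
pose y := \sum_(T | full_cone F T) \sum_(i in T) r i *: ldual F T i.
pose q := #|[set T | full_cone F T]|.
have [T0 tT0 _] := full_cone_cover F 0.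
exists y, q; split; first by apply/card_gt0P; exists T0; rewrite inE.
move=> j.
have -> : zdot y (v j) = \sum_(T | full_cone F T) lin_ext F r T (v j).
  rewrite zdot_suml; apply: eq_bigr => T _; rewrite zdot_suml.
  by apply: eq_bigr => i _; rewrite zdotZl mulrC.
have [T tT Tpos] := full_cone_cover F (- v j).
have jT : j \notin T.
  apply/negP => jT; have := Tpos j jT.
  by rewrite coordzN coordz_ray ?full_cone_in // eqxx oppr_ge0.
have -> : r j *+ q = \sum_(T | full_cone F T) r j.
  by rewrite sumr_const /q; congr (_ *+ _); apply: eq_card => U; rewrite inE.
rewrite (bigD1 T) //= [X in _ <= X](bigD1 T) //= addrAC lerD //.
  by rewrite -ltzD1 ltrD2r rconv.
apply: ler_sum => U /andP[tU _]; have [jU|jU] := boolP (j \in U).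
  by rewrite lin_ext_ray.
by rewrite ltW // rconv.
Qed.

(** The cube of side K at a multiple of an interior point proportional to K has
    all its slacks at most [- c]. *)
Lemma slack_sum_lower_bound c G : clamped c set0 G -> (forall s, 0 <= G s) ->
  (forall s, (forall j, s j <= - c) -> 1 <= G s) ->
  exists2 C : nat, (0 < C)%N &
    forall K, ((K.+1 ^ d)%N)%:Z <= slack_sum G (C * K.+1)%N.
Proof.
move=> [c0 G0 _ _] Gge0 G1; have [y [q [q0 yq]]] := interior_point.
pose w j (i : 'I_d) : nat := absz (v j 0 i).
pose V := (\sum_j \sum_i w j i)%N.
pose W := (V + absz c + 1)%N.
exists (q * W)%N => [|K]; first by rewrite muln_gt0 q0 /W addn1.
set N := (_ * _)%N; pose M := (W * K.+1)%N.
pose pt (t : {ffun 'I_d -> 'I_K.+1}) : 'rV[int]_d := y *+ M + \row_i (t i)%:Z.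
have pt_inj : injective pt.
  move=> t t' /addrI /rowP E; apply/ffunP => i; apply/val_inj.
  by have := E i; rewrite !mxE => -[].
pose p' := [seq pt t | t <- enum {ffun 'I_d -> 'I_K.+1}].
have up' : uniq p' by rewrite map_inj_uniq ?enum_uniq.
have sp' : size p' = (K.+1 ^ d)%N by rewrite size_map -cardE card_ffun !card_ord.
have Gp' u : u \in p' -> 1 <= G (slack N u).
  case/mapP => t _ ->; apply: G1 => j; rewrite /slack zdotDl zdotMnl.
  have NE : N = (q * M)%N by rewrite /N /M mulnA.
  have yM : zdot y (v j) *+ M + M%:Z <= r j *+ N.
    by rewrite NE [r j *+ _]mulrnA -[X in _ + X]natz -mulrnDl lerMn2r yq orbT.
  have tV : zdot (\row_i (t i)%:Z) (v j) <= (K * V)%:Z.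
    have wV : (\sum_i w j i <= V)%N by rewrite /V (bigD1 j) //= leq_addr.
    apply: (@le_trans _ _ (K * \sum_i w j i)%N%:Z); last by rewrite lez_nat leq_mul2l wV orbT.
    rewrite big_distrr /= (big_morph Posz PoszD (erefl 0)).
    apply: ler_sum => i _; rewrite mxE; apply: le_trans (ler_norm _) _.
    by rewrite normrM PoszM /w abszE ler_wpM2r // ger0_norm // lez_nat -ltnS ltn_ord.
  have cM : (absz c + K * V <= M)%N by rewrite /M /W; nia.
  rewrite lerBlDr; apply: le_trans (lerD (lexx _) tV) _; apply: le_trans (lerD (lexx _) yM).
  by move: (_ *+ _) => a; lia.
have [p up pP] := slack_support c N.
rewrite /slack_sum (@fsum_seq _ p) //; last by move=> u /pP[j]; apply: G0.
apply: (@le_trans _ _ (\sum_(u <- p) (u \in p')%:R)).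
  rewrite (_ : \sum_(u <- p) _ = (size [seq u <- p | u \in p'])%:Z); last first.
    rewrite size_filter -sum1_count (big_morph Posz PoszD (erefl 0)) [RHS]big_mkcond.
    by apply: eq_bigr => u _; case: (u \in p').
  rewrite lez_nat -sp' uniq_leq_size // => u up'u.
  rewrite mem_filter up'u /=; apply: contraT => /pP[j /G0 E].
  by have := Gp' u up'u; rewrite E.
apply: ler_sum => u _; case: (boolP (u \in p')) => [/Gp'|_] //.
Qed.

End LatticePointSums.

(** * Ranks of sections as functions of the slacks *)

Section RankFunctions.
Variables (n m : nat) (M : matroid 'I_m) (w : 'I_n -> 'rV[int]_m).
Implicit Types (S : {set 'I_n}) (s : 'I_n -> int).

Definition above S s : {set 'I_m} :=
  [set e | [forall (j | j \in S), s j <= w j 0 e]].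

Definition rank_above S s : int := (mrank M (above S s))%:Z.

Definition level_bound : int := \sum_j \sum_e `|w j 0 e|.

Lemma level_boundP j e : `|w j 0 e| <= level_bound.
Proof.
rewrite /level_bound (bigD1 j) //= (bigD1 e) //= -addrA lerDl addr_ge0 //.
  exact: sumr_ge0.
by apply: sumr_ge0 => i _; apply: sumr_ge0.
Qed.

Lemma mrank_set0 : mrank M set0 = 0%N.
Proof.
apply: big1 => I /andP[]; rewrite subset0 => /eqP -> _; exact: cards0.
Qed.

Lemma rank_above_eq0 S s j : j \in S -> level_bound < s j -> rank_above S s = 0.
Proof.
move=> jS sj; rewrite /rank_above (_ : above S s = set0) ?mrank_set0 //.
apply/setP => e; rewrite !inE; apply/negP => /'forall_implyP/(_ j jS).
have := level_boundP j e; lia.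
Qed.

Lemma above_low S s s' :
  (forall j, j \in S -> s j = s' j \/ s j <= - level_bound /\ s' j <= - level_bound) ->
  above S s = above S s'.
Proof.
move=> ss'; apply/setP => e; rewrite !inE; apply: eq_forallb => j.
have [jS /=|//] := boolP (j \in S).
have := level_boundP j e; case: (ss' j jS) => [->//|]; lia.
Qed.

Lemma rank_above_low S s :
  rank_above S s = rank_above (S :&: [set j | - level_bound < s j]) s.
Proof.
congr (mrank M _)%:Z; apply/setP => e; rewrite !inE; apply: eq_forallb => j.
rewrite !inE; have [jS /=|//] := boolP (j \in S).
by have := level_boundP j e; case: ltrP => //=; lia.
Qed.

Lemma rank_above_setT s : (forall j, s j <= - level_bound) ->
  rank_above setT s = (mrank M setT)%:Z.
Proof.
move=> sl; congr (mrank M _)%:Z; apply/setP => e; rewrite !inE.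
by apply/'forall_implyP => j _; have := level_boundP j e; have := sl j; lia.
Qed.

Lemma clamped_rank_above : clamped level_bound set0 (rank_above setT).
Proof.
split.
- by apply: sumr_ge0 => j _; apply: sumr_ge0.
- by move=> s j; apply: rank_above_eq0; rewrite inE.
- by move=> s s' ss'; congr (mrank M _)%:Z; apply: above_low => j _; apply: ss'.
- by move=> s j; rewrite inE.
Qed.

End RankFunctions.

Lemma sections_tensor (R : realType) (d n m : nat) (Sigma : complete_fan R d n)
    (smoothS : smooth Sigma) (M : matroid 'I_m) (E : tropical_bundle Sigma M)
    (L : line_bundle Sigma) (F : lattice_fan d n) (w : 'I_n -> 'rV[int]_m) N S u :
  lray F = ray Sigma -> (forall j, Phi E (emb R (ray Sigma j)) = emb R (w j)) ->
  sections (tensor smoothS E (lpow L N)) S u = above w S (slack F (lcoef L) N u).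
Proof.
move=> rE wE; apply/setP => e; rewrite !inE; apply: eq_forallb => j.
congr implb; rewrite pairing_emb /= /tensor_fun mxE wE mxE.
by rewrite lpsi_ray -intrD ler_int /slack rE lerBlDr.
Qed.

(** * The theorem *)

Theorem theorem1p9 (R : realType) (d n m : nat)
    (Sigma : complete_fan R d n) (smoothS : smooth Sigma)
    (projS : projective Sigma)
    (M : matroid 'I_m) (loopM : loopfree M)
    (rankM : (1 <= mrank M [set: 'I_m]%SET)%N)
    (E : tropical_bundle Sigma M)
    (L : line_bundle Sigma) (ampleL : ample L) :
  exists N0 : nat, (0 < N0)%N /\
    (forall N : nat, (N0 <= N)%N -> forall u : 'rV[int]_d,
       chi_deg (tensor smoothS E (lpow L N)) u
         = (h0_deg (tensor smoothS E (lpow L N)) u)%:Z) /\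
    exists P : {poly rat},
      [/\ size P = d.+1,
          forall k : int, P.[k%:~R] \is a Num.int &
          forall N : nat, (N0 <= N)%N ->
            P.[N%:R] = (h0 (tensor smoothS E (lpow L N)))%:R].
Proof.
have [F [rE cE]] := lattice_fan_of_smooth smoothS.
have rconv := ample_strictly_convex rE cE ampleL.
have [w wE] := choice (fun j => Phi_int E (ray Sigma j)).
set r := lcoef L in rconv; pose G := rank_above M w setT.
have clampedG := clamped_rank_above M w.
have c0 : 0 <= level_bound w by case: clampedG.
have h0E N : (h0 (tensor smoothS E (lpow L N)))%:Z = slack_sum F r G N.
  have [p up pP] := slack_support F r (level_bound w) N.
  have degE u : (h0_deg (tensor smoothS E (lpow L N)) u)%:Z = G (slack F r N u).
    by rewrite /h0_deg (sections_tensor smoothS L N setT u rE wE).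
  have G0 u : u \notin p -> G (slack F r N u) = 0.
    by move=> /pP[j]; case: clampedG => _ G0 _ _; apply: G0.
  rewrite /slack_sum (fsum_seq up G0) /h0 (fsbigE p) //; last first.
    by move=> u _ /G0; rewrite -degE => -[].
  rewrite (big_morph Posz PoszD (erefl 0)).
  by apply: eq_big => [u|u _]; [rewrite mem_set | rewrite degE].
have large_chi : for_large (fun N => forall u,
    chi_deg (tensor smoothS E (lpow L N)) u
      = (h0_deg (tensor smoothS E (lpow L N)) u)%:Z).
  apply: for_large_mono (euler_rank rconv c0) => N euler u.
  rewrite /h0_deg (sections_tensor smoothS L N setT u rE wE).
  rewrite -[RHS](euler u (slack F r N u) (fun S => rank_above M w S (slack F r N u))) //.
  - rewrite /chi_deg cE; apply: eq_bigr => S SF.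
    by rewrite (codim_card rE cE SF) (sections_tensor smoothS L N S u rE wE).
  - by move=> S j; apply: rank_above_eq0.
  - by move=> S; apply: rank_above_low.
have [P [sP iP PE]] := slack_sum_polynomial rconv clampedG.
have [N0 N0P] := for_large_and large_chi (for_large_and PE (for_large_ltn 0)).
exists N0.+1; split=> //; split; first by move=> N /ltnW/N0P[].
exists P; split=> //; last first.
  move=> N /ltnW/N0P[_ [-> _]].
  by rewrite -h0E.
(* If the degree were less than d, then N h0(N) would be bounded by a multiple of
   N^d, whereas along the multiples of C, h0(N) itself is at least of order N^d. *)
apply/eqP; rewrite eqn_leq; rewrite cards0 subn0 in sP; rewrite sP ltnNge /=.
apply/negP => /poly_growth[A growth].
have [C C0 lower] : exists2 C : nat, (0 < C)%N &
    forall K, ((K.+1 ^ d)%N)%:Z <= slack_sum F r G (C * K.+1)%N.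
  by apply: slack_sum_lower_bound clampedG _ _ => // s sl; rewrite /G rank_above_setT.
pose a := A * C%:R ^+ d; pose K := maxn N0 (Num.bound `|a|).
have aK : a < K.+1%:R.
  apply: le_lt_trans (ler_norm a) _.
  apply: lt_le_trans (archi_boundP (normr_ge0 a)) _.
  by rewrite ler_nat leqW // leq_maxr.
have KC : (K < C * K.+1)%N by rewrite leq_pmull.
have N0K : (N0 <= C * K.+1)%N by rewrite (leq_trans _ (ltnW KC)) // leq_maxl.
have [_ [PK _]] := N0P _ N0K.
have := growth (C * K.+1)%N (leq_ltn_trans (leq0n K) KC).
rewrite PK natrM exprMn mulrA -/a => upper.
have low : K.+1%:R ^+ d <= (slack_sum F r G (C * K.+1)%N)%:~R :> rat.
  by rewrite -natrX -[_%:R]/((Posz (K.+1 ^ d))%:~R) ler_int.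
have N_pos : 0 <= C%:R * K.+1%:R :> rat by rewrite -natrM ler0n.
have := le_trans (ler_wpM2l N_pos low) upper.
rewrite ler_pM2r ?exprn_gt0 ?ltr0n // => /le_lt_trans/(_ aK).
by rewrite -natrM ltr_nat ltnNge KC.
Qed.
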